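(* Let $\Sigma$ be a finite alphabet of size $\sigma$, and let $S\in \Sigma^n$ be a string chosen uniformly at random. Let $L(S)$ denote the maximum length of an unbordered factor of $S$ and $\operatorname{per}(S)$ the shortest period of $S$. (a) The problem of computing $L(S)$ can be reduced, in $O(\log_\sigma n)$ expected time, to the problem of computing $\operatorname{per}(S')$ for a fixed factor $S'$ of $S$ (that is, there is an algorithm that computes $L(S)$ using one computation of $\operatorname{per}(S')$ for a factor $S'$ of $S$ whose position is determined independently of the content of $S$, and whose remaining work takes $O(\log_\sigma n)$ expected time). (b) The problem of computing $\operatorname{per}(S)$ can be reduced in $O(1)$ expected time to the problem of computing $L(S)$ (that is, given $L(S)$, the value $\operatorname{per}(S)$ can be computed in $O(1)$ additional expected time).
   Context: A string $S\in\Sigma^n$ is a sequence $S[1]\cdots S[n]$ of symbols from $\Sigma$; for $1\le i\le j\le n$, the factor $S[i,j]$ is $S[i]\cdots S[j]$. A border of $S$ is a non-empty prefix of $S$ that is also a suffix of $S$; $S$ is unbordered if it has no border other than itself. $L(S)$ is the maximum length of an unbordered factor of $S$. An integer $p>0$ is a period of $S$ if $S[i]=S[i+p]$ for all $1\le i\le n-p$; $\operatorname{per}(S)$ is the smallest period of $S$. *)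

(* Defs.v *)
From HB Require Import structures.
From mathcomp Require Import all_boot all_order all_algebra.
From mathcomp Require Import boolp reals exp.

Set Implicit Arguments.
Unset Strict Implicit.
Unset Printing Implicit Defensive.

Import Order.TTheory GRing.Theory Num.Theory.

Section Strings.
Variable T : eqType.
Implicit Types (S U : seq T) (i j p : nat).

(* Positions are 1-based, as in S[1] ... S[n]; meaningful for 1 <= i <= j <= n. *)
Definition factor S i j : seq T := drop i.-1 (take j S).

Definition border U S : bool := [&& U != [::], prefix U S & suffix U S].

Definition unbordered S : Prop := forall U, border U S -> U = S.

Definition L S : nat :=
  \max_(i < (size S).+1)
    \max_(j < (size S).+1 | (0 < i <= j) && `[< unbordered (factor S i j) >])
      size (factor S i j).

(* 0-based rendering of: p > 0 and S[i] = S[i + p] for 1 <= i <= n - p. *)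
Definition period S p : bool :=
  (0 < p) && [forall i : 'I_(size S - p), onth S i == onth S (i + p)].

Lemma period_exists S : exists p, period S p.
Proof.
exists (size S).+1; apply/andP; split => //.
by apply/forallP => -[i]; rewrite subnS subnn.
Qed.

Definition per S : nat := ex_minn (period_exists S).

End Strings.

(* A unit-cost word RAM, presented as a structured language.  All values are   *)
(* natural numbers below a word bound [W]: an operation whose result does not  *)
(* fit in a word, an input access outside [1, n], or a query that is not a     *)
(* valid factor has no result, so a program performing it does not terminate   *)
(* in the sense of [exec].                                                     *)

Inductive binop := OpAdd | OpSub | OpMul | OpDiv | OpMod | OpEq | OpLt.

Inductive expr :=
| ELit of nat
| EReg of nat
| EMem of expr
| ESym of expr
| EBin of binop & expr & expr.

Inductive cmd :=
| CSkip
| CAssign of nat & expr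
| CStore of expr & expr
| CQuery of nat & expr & expr
| CSeq of cmd & cmd
| CIf of expr & cmd & cmd
| CWhile of expr & cmd.

Record state := State { regs : nat -> nat; memory : nat -> nat }.

Definition upd (f : nat -> nat) (a v : nat) : nat -> nat :=
  fun b => if b == a then v else f b.

Definition set_reg (s : state) x v := State (upd (regs s) x v) (memory s).
Definition set_mem (s : state) a v := State (regs s) (upd (memory s) a v).

(* Subtraction is truncated; x %/ 0 = 0 and x %% 0 = x. *)
Definition binop_sem (o : binop) (x y : nat) : nat :=
  match o with
  | OpAdd => x + y
  | OpSub => x - y
  | OpMul => x * y
  | OpDiv => x %/ y
  | OpMod => x %% y
  | OpEq => x == y
  | OpLt => x < y
  end.

Fixpoint expr_cost (e : expr) : nat :=
  match e with
  | ELit _ | EReg _ => 1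
  | EMem e | ESym e => (expr_cost e).+1
  | EBin _ e1 e2 => (expr_cost e1 + expr_cost e2).+1
  end.

Section Semantics.
Variable W : nat.
Variable input : seq nat.
Variable oracle : nat -> nat -> nat.

Definition word (v : nat) : option nat := if v < W then Some v else None.

Fixpoint eval (s : state) (e : expr) : option nat :=
  match e with
  | ELit k => word k
  | EReg x => word (regs s x)
  | EMem e => if eval s e is Some a then word (memory s a) else None
  | ESym e => if eval s e is Some i.+1 then obind word (onth input i) else None
  | EBin o e1 e2 =>
      match eval s e1, eval s e2 with
      | Some x, Some y => word (binop_sem o x y)
      | _, _ => None
      end
  end.

(* [exec s c s' t qs]: from [s], command [c] terminates in [s'] after [t] time *)
(* units, having issued exactly the oracle queries [qs], in this order.        *)
(* Issuing a query and receiving its answer takes one unit (besides evaluating *)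
(* its endpoints); the work of the oracle itself is not counted.               *)
Inductive exec : state -> cmd -> state -> nat -> seq (nat * nat) -> Prop :=
| ExecSkip s : exec s CSkip s 1 [::]
| ExecAssign s x e v :
    eval s e = Some v ->
    exec s (CAssign x e) (set_reg s x v) (expr_cost e).+1 [::]
| ExecStore s ea ev a v :
    eval s ea = Some a -> eval s ev = Some v ->
    exec s (CStore ea ev) (set_mem s a v) (expr_cost ea + expr_cost ev).+1 [::]
| ExecQuery s x ei ej i j :
    eval s ei = Some i -> eval s ej = Some j ->
    0 < i <= j -> j <= size input ->
    exec s (CQuery x ei ej) (set_reg s x (oracle i j))
      (expr_cost ei + expr_cost ej).+1 [:: (i, j)]
| ExecSeq s c1 c2 s1 s2 t1 t2 q1 q2 :
    exec s c1 s1 t1 q1 -> exec s1 c2 s2 t2 q2 ->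
    exec s (CSeq c1 c2) s2 (t1 + t2) (q1 ++ q2)
| ExecIf s e c1 c2 v s' t q :
    eval s e = Some v -> exec s (if v != 0 then c1 else c2) s' t q ->
    exec s (CIf e c1 c2) s' ((expr_cost e).+1 + t) q
| ExecWhileEnd s e c :
    eval s e = Some 0 -> exec s (CWhile e c) s (expr_cost e).+1 [::]
| ExecWhileStep s e c v s1 s2 t1 t2 q1 q2 :
    eval s e = Some v.+1 ->
    exec s c s1 t1 q1 -> exec s1 (CWhile e c) s2 t2 q2 ->
    exec s (CWhile e c) s2 ((expr_cost e).+1 + t1 + t2) (q1 ++ q2).

Lemma exec_det s c s1 t1 q1 :
  exec s c s1 t1 q1 -> forall s2 t2 q2, exec s c s2 t2 q2 ->
  [/\ s1 = s2, t1 = t2 & q1 = q2].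
Proof.
elim=> {s c s1 t1 q1} >; intros;
  match goal with H : exec _ _ _ _ _ |- _ => inversion H; subst; clear H end;
  repeat match goal with
  | E : eval ?s ?e = Some _, E' : eval ?s ?e = Some _ |- _ =>
      rewrite E in E'; case: E' => E'; subst
  | IH : forall s2 t2 q2, exec ?s ?c _ _ _ -> _, H : exec ?s ?c _ _ _ |- _ =>
      case: (IH _ _ _ H) => ? ? ?; subst; clear H
  end; by [].
Qed.

End Semantics.

(* Register 0 holds n and register 1 holds sigma. *)
Definition init_state (n sigma : nat) : state :=
  State (fun x => match x with 0 => n | 1 => sigma | _ => 0 end) (fun=> 0).

(* The machine has words of (k + 1) log2 (n + sigma) bits and read-only access *)
(* to the symbols of [S], encoded as 0, ..., sigma - 1.  The output is left in *)
(* register 0; the oracle computes [G] on factors of [S].                      *)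
Definition computes_with_query (Sigma : finType) (k : nat) (P : cmd)
    (F G : seq Sigma -> nat) (S : seq Sigma) (i j t : nat) : Prop :=
  let n := size S in
  let sigma := #|Sigma| in
  exists s : state,
    exec ((n + sigma) ^ k.+1)
         [seq nat_of_ord (enum_rank a) | a <- S]
         (fun i' j' => G (factor S i' j'))
         (init_state n sigma) P s t [:: (i, j)]
    /\ regs s 0 = F S.

Local Open Scope ring_scope.

Definition uniform_mean (R : realType) (Sigma : finType) (n : nat)
    (X : n.-tuple Sigma -> nat) : R :=
  (\sum_(S : n.-tuple Sigma) (X S)%:R) / #|{: n.-tuple Sigma}|%:R.

Definition logb (R : realType) (b x : nat) : R := ln x%:R / ln b%:R.

(* Main.v *)
Require Import Defs.
From HB Require Import structures.
From mathcomp Require Import all_boot all_order all_algebra.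
From mathcomp Require Import boolp reals sequences exp.
From mathcomp Require Import zify ring lra.

(** A bordered string has the form [u v u] with [u] its shortest border, and [u]
    is independent of [v] under the uniform distribution; since [L v <= L (u v u)],
    the defect [n - L S] is dominated by a sum of lengths of shortest borders
    stopped as soon as the core is unbordered. A generating-function recursion
    then gives [E (w ^ (n - L S)) <= 10] for [w = sigma ^ (1/16)].

    For (b), [L S <= per S], so testing the candidate periods [L S, L S + 1, ...]
    costs [O ((n - L S + 1) ^ 2)] steps, which is [O(1)] on average.

    For (a), let [S'] be [S] without [d = 64 * up_log sigma n] symbols at both
    ends. A border of length [b] of a factor of length [l] containing [S'] makes
    [l - b] a period of [S'], so once [per S'] is known only the borders of length
    at most [l - per S'] have to be excluded. Factors are scanned by decreasing
    length; with probability [1 - O(n^-4)] the search stops within [d] rounds and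
    [per S' >= |S'| - d], so each factor needs [O(log_sigma n)] comparisons of
    expected constant cost. *)

Set Implicit Arguments.
Unset Strict Implicit.
Unset Printing Implicit Defensive.

Import Order.TTheory GRing.Theory Num.Theory.

(** * Agreement of a string with its shifts *)

Lemma onth_drop (T : Type) (s : seq T) k t : onth (drop k s) t = onth s (k + t).
Proof.
by elim: s k => [|x s IHs] [|k] //=; rewrite ?onth0n // IHs.
Qed.

Lemma onth_take (T : Type) (s : seq T) k t :
  onth (take k s) t = if t < k then onth s t else None.
Proof.
elim: s k t => [|x s IHs] [|k] [|t] //=; first by case: ifP.
by rewrite IHs.
Qed.

Section Agree.
Variable T : eqType.
Implicit Types (s u v : seq T) (a q b t : nat).

(** Borders and periods are both instances of this predicate, with 0-based positions: a border of
    length [b] of the factor of length [l] at [a] is [agree s a (l - b) b], and a period [p] of [s]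
    is [agree s 0 p (size s - p)]. *)
Definition agree s a q b : bool :=
  all (fun t => onth s (a + t) == onth s (a + q + t)) (iota 0 b).

(** The longest common prefix of the two windows, capped at [b]. It counts the successful symbol
    comparisons, hence measures the cost of one test. *)
Definition agree_len s a q b : nat :=
  find (fun t => onth s (a + t) != onth s (a + q + t)) (iota 0 b).

Lemma agreeP s a q b :
  reflect (forall t, t < b -> onth s (a + t) = onth s (a + q + t))
          (agree s a q b).
Proof.
apply: (iffP allP) => [H t lt_tb | H t].
  by apply/eqP/H; rewrite mem_iota.
by rewrite mem_iota /= => lt_tb; rewrite H.
Qed.

Lemma agreeS s a q b :
  agree s a q b.+1 = (onth s a == onth s (a + q)) && agree s a.+1 q b.
Proof.
apply/agreeP/andP => [H | [/eqP H0 /agreeP H] [|t] lt_tb].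
- split; first by have := H 0 isT; rewrite !addn0 => ->.
  apply/agreeP => t lt_tb; have := H t.+1 lt_tb.
  by congr (onth _ _ = onth _ _); lia.
- by rewrite !addn0.
- by have := H t lt_tb; congr (onth _ _ = onth _ _); lia.
Qed.

Lemma agree_len_leq s a q b : agree_len s a q b <= b.
Proof. by rewrite -[leqRHS](size_iota 0 b) find_size. Qed.

Lemma agree_leq_len s a q b t : t <= agree_len s a q b -> agree s a q t.
Proof.
move=> le_t; apply/agreeP => r lt_rt.
have lt_r : r < agree_len s a q b by apply: leq_trans le_t.
have := before_find 0 lt_r; rewrite nth_iota ?add0n => [/negbFE/eqP //|].
exact: leq_trans lt_r (agree_len_leq _ _ _ _).
Qed.

Lemma agree_len_eq s a q b : (agree_len s a q b == b) = agree s a q b.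
Proof.
apply/idP/idP => [/eqP E | H]; first by apply: (@agree_leq_len _ _ _ b); rewrite E.
rewrite eqn_leq agree_len_leq /= leqNgt -[X in _ < X](size_iota 0 b) -has_find.
by rewrite -all_predC; apply: sub_all H => t /=; rewrite negbK.
Qed.

Lemma agree_len_neq s a q b : agree_len s a q b < b ->
  onth s (a + agree_len s a q b) != onth s (a + q + agree_len s a q b).
Proof.
move=> lt_b; have := lt_b.
rewrite -[X in _ < X](size_iota 0 b) -has_find => /(nth_find 0).
by rewrite nth_iota // add0n.
Qed.

Lemma periodP s p : period s p = (0 < p) && agree s 0 p (size s - p).
Proof.
congr (_ && _); apply/forallP/agreeP => [H t lt_t | H i].
  by have /eqP := H (Ordinal lt_t); rewrite add0n addnC.
by rewrite -{1}[i : nat]add0n (H i (ltn_ord i)) add0n addnC.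
Qed.

Lemma unborderedP s :
  unbordered s <-> forall b, 0 < b < size s -> ~~ agree s 0 (size s - b) b.
Proof.
split=> [H b /andP[b0 bn] | H U /and3P[nU]].
  apply/negP => /agreeP Hb.
  have sU : size (take b s) = b by rewrite size_takel // ltnW.
  have /H /(congr1 size) : border (take b s) s; last by rewrite sU; lia.
  apply/and3P; split; [by rewrite -size_eq0 sU; lia | exact: prefix_take |].
  rewrite suffixE sU; apply/eqP/eq_from_onth => t.
  rewrite onth_drop onth_take; case: ltnP => lt_t; first by have:= Hb t lt_t.
  by rewrite onth_default //; lia.
rewrite prefixE suffixE => /eqP pU /eqP sU.
have le_U : size U <= size s by rewrite -pU size_take_min geq_minr.
move: le_U; rewrite leq_eqVlt => /orP[/eqP E | lt_U].
  by rewrite -pU E take_size.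
have /negP[] : ~~ agree s 0 (size s - size U) (size U).
  by apply: H; rewrite lt0n size_eq0 nU.
apply/agreeP => t lt_t; rewrite add0n add0n -onth_drop sU -[in RHS]pU onth_take.
by rewrite lt_t.
Qed.

(** * Unbordered factors and their maximum length *)

Lemma size_factor s i j : j <= size s -> size (factor s i j) = j - i.-1.
Proof. by move=> le_j; rewrite size_drop size_takel. Qed.

Lemma onth_factor s i j t : i.-1 + t < j -> onth (factor s i j) t = onth s (i.-1 + t).
Proof. by move=> lt_j; rewrite onth_drop onth_take lt_j. Qed.

(** From here on a factor is addressed by its 0-based offset [i] and its length [l], which turns its
    borders into agreements inside [s] itself. *)
Lemma unbordered_factorP s i l : i + l <= size s ->
  unbordered (factor s i.+1 (i + l)) <->
  forall b, 0 < b < l -> ~~ agree s i (l - b) b.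
Proof.
move=> le_il; rewrite unborderedP size_factor //= addKn.
suff E b : 0 < b < l ->
    agree (factor s i.+1 (i + l)) 0 (l - b) b = agree s i (l - b) b.
  by split=> H b Hb; [rewrite -E // H | rewrite E // H].
move=> Hb; apply/agreeP/agreeP => H t lt_t; have := H t lt_t;
  rewrite !onth_factor /=; rewrite -?addnA //; lia.
Qed.

Lemma L_geq s i l : 0 < l -> i + l <= size s ->
  unbordered (factor s i.+1 (i + l)) -> l <= L s.
Proof.
move=> l0 le_il U; have lt_i : i.+1 < (size s).+1 by lia.
have lt_j : i + l < (size s).+1 by lia.
apply: leq_trans (leq_bigmax (Ordinal lt_i)) => /=.
have C : (0 < i.+1 <= i + l) && `[< unbordered (factor s i.+1 (i + l)) >].
  by apply/andP; split; [lia | apply/asboolP].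
apply: leq_trans (leq_bigmax_cond (Ordinal lt_j) C).
by rewrite size_factor //= addKn.
Qed.

Lemma L_leq s m :
  (forall i l, 0 < l -> i + l <= size s ->
     unbordered (factor s i.+1 (i + l)) -> l <= m) -> L s <= m.
Proof.
move=> H; apply/bigmax_leqP => -[i lt_i] _.
apply/bigmax_leqP => -[j lt_j] /= /andP[/andP[i0 le_ij] /asboolP U].
have -> : size (factor s i j) = j - i.-1 by rewrite size_factor.
apply: (H i.-1); rewrite ?subnKC ?prednK //; lia.
Qed.

Lemma L_gt0 s : 0 < size s -> 0 < L s.
Proof.
move=> n0; apply: (@L_geq s 0 1) => //.
by apply/(@unbordered_factorP s 0 1) => // b; lia.
Qed.

Lemma L_attained s : 0 < size s ->
  exists i, i + L s <= size s /\ unbordered (factor s i.+1 (i + L s)).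
Proof.
move=> n0; apply: contrapT => H.
have : L s <= (L s).-1; last by have := L_gt0 n0; lia.
apply: L_leq => i l l0 le_il U; have := L_geq l0 le_il U.
rewrite leq_eqVlt => /orP[/eqP El | ]; last by lia.
by case: H; exists i; rewrite -El.
Qed.

Lemma L_leq_size s : L s <= size s.
Proof. by apply: L_leq => i l _ le_il _; lia. Qed.

Lemma L_unbordered s : unbordered s -> L s = size s.
Proof.
move=> U; apply/eqP; rewrite eqn_leq L_leq_size /=.
case: (posnP (size s)) => [-> // | n0].
apply: (@L_geq s 0 (size s)) => //.
by rewrite add0n /factor take_size drop0.
Qed.

Lemma L_infix u s v : L s <= L (u ++ s ++ v).
Proof.
apply: L_leq => i l l0 le_il /(unbordered_factorP le_il) U.
have le_il' : size u + i + l <= size (u ++ s ++ v) by rewrite !size_cat; lia.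
apply: (L_geq l0 le_il'); apply/(unbordered_factorP le_il') => b Hb.
have Hcat r : r < size s -> onth (u ++ s ++ v) (size u + r) = onth s r.
  by move=> lt_r; rewrite onth_cat ltnNge leq_addr /= addKn onth_cat lt_r.
apply: contra (U b Hb) => /agreeP H; apply/agreeP => t lt_t.
by have := H t lt_t; rewrite -!addnA !Hcat //; lia.
Qed.

(** * Periods, shortest borders and the defect *)

Lemma perP s : period s (per s).
Proof. by rewrite /per; case: ex_minnP. Qed.

Lemma per_leq s p : period s p -> per s <= p.
Proof. by rewrite /per; case: ex_minnP => m _; apply. Qed.

Lemma per_gt0 s : 0 < per s.
Proof. by have /andP[] := perP s. Qed.

Lemma per_leq_size s : 0 < size s -> per s <= size s.
Proof. by move=> n0; apply: per_leq; rewrite periodP n0 subnn. Qed.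

(** A factor of length [l > per s] inherits the period, so it has a border of length [l - per s]. *)
Lemma L_leq_per s : L s <= per s.
Proof.
apply: L_leq => i l l0 le_il /(unbordered_factorP le_il) U.
rewrite leqNgt; apply/negP => lt_pl; have p0 := per_gt0 s.
have /negP[] := U (l - per s) ltac:(lia).
have /andP[_] : (0 < per s) && agree s 0 (per s) (size s - per s).
  by rewrite -periodP perP.
move/agreeP => H; apply/agreeP => t lt_t.
by have := H (i + t) ltac:(lia); rewrite !add0n => ->; congr onth; lia.
Qed.

(** The two agreeing windows together cover the positions from [a] to [a + q + b], and everything
    inside that range has period [q]. This turns a border of a long factor into a period of the
    queried factor. *)
Lemma period_factor s i j a q b : i < j <= size s ->
  agree s a q b -> 0 < q -> a <= i -> j <= a + q + b ->
  period (factor s i.+1 j) q.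
Proof.
move=> Hij /agreeP H q0 le_a le_j; rewrite periodP q0 size_factor /=; last lia.
apply/agreeP => t lt_t; rewrite !onth_factor /=; try lia.
have := H (i - a + t) ltac:(lia).
by congr (onth _ _ = onth _ _); lia.
Qed.

(** Take the shortest border. If its two occurrences overlapped, the overlap would be a shorter
    border, so the string is [u ++ v ++ u]. If [u] had length at least 2 and equal end symbols, that
    single symbol would be a shorter border. *)
Lemma bordered_decomp s : ~ unbordered s ->
  exists u v : seq T, [/\ s = u ++ v ++ u, 0 < size u &
     (size u == 1) || (ohead u != ohead (rev u))].
Proof.
move=> nU.
have ex : exists b, (0 < b < size s) && agree s 0 (size s - b) b.
  apply: contra_notP nU => nex; apply/unborderedP => b Hb.
  by apply/negP => Ha; apply: nex; exists b; rewrite Hb.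
case: (ex_minnP ex) => b /andP[/andP[b0 lt_b] /agreeP Hb] min_b.
have le_2b : b + b <= size s.
  rewrite leqNgt; apply/negP => gt_2b.
  have : b <= b + b - size s; last by lia.
  apply: min_b; apply/andP; split; first lia.
  apply/agreeP => t lt_t; rewrite !add0n.
  have := Hb t ltac:(lia); rewrite !add0n => ->.
  have := Hb (size s - b + t) ltac:(lia); rewrite !add0n => ->.
  congr onth; lia.
have E : take b s = drop (size s - b) s.
  apply: eq_from_onth => t; rewrite onth_take onth_drop.
  case: ltnP => lt_t; first by have := Hb t lt_t.
  by rewrite onth_default //; lia.
have su : size (take b s) = b by rewrite size_takel // ltnW.
exists (take b s), (drop b (take (size s - b) s)); split; last 2 first.
- by rewrite su.
- rewrite su; case: eqVneq => //= b1.
  apply/eqP => Eh; have : b <= 1; last lia.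
  apply: min_b; apply/andP; split; first lia.
  apply/agreeP => t; rewrite ltnS leqn0 => /eqP ->; rewrite add0n addn0.
  have hd r : ohead r = onth r 0 :> option T by case: r.
  have -> : onth s 0 = ohead (take b s) by rewrite hd onth_take b0.
  rewrite Eh hd E.
  have n0 : 0 < size (drop (size s - b) s) by rewrite size_drop; lia.
  have [r [x Er]] : exists r x, drop (size s - b) s = rcons r x.
    by case/lastP: (drop _ _) n0 => // r x _; exists r, x.
  rewrite Er rev_rcons /=.
  have : onth (drop (size s - b) s) b.-1 = onth (rcons r x) b.-1 by rewrite Er.
  have -> : b.-1 = size r.
    by have := congr1 size Er; rewrite size_drop size_rcons; lia.
  rewrite -cats1 onth_cat ltnn subnn /= => <-; rewrite onth_drop; congr onth.
  by have := congr1 size Er; rewrite size_drop size_rcons; lia.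
rewrite [in X in _ ++ _ ++ X]E.
rewrite catA -{1}(cat_take_drop (size s - b) s); congr (_ ++ _).
rewrite -{1}(cat_take_drop b (take (size s - b) s)); congr (_ ++ _).
by rewrite take_takel //; lia.
Qed.

Definition defect s : nat := size s - L s.

Lemma defect_unbordered s : unbordered s -> defect s = 0.
Proof. by move=> U; rewrite /defect (L_unbordered U) subnn. Qed.

(** The longest unbordered factor of the core survives, so the defect grows at most by the number of
    added symbols. *)
Lemma defect_infix u s v :
  defect (u ++ s ++ v) <= size u + size v + defect s.
Proof.
have := L_infix u s v; have := L_leq_size s; rewrite /defect !size_cat.
by lia.
Qed.

End Agree.

(** * Programs *)

Arguments upd f a v b /.

(** * A program logic with time bounds *)

Section Runs.
Variables (W : nat) (input : seq nat) (oracle : nat -> nat -> nat).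
Implicit Types (s : state) (c : cmd) (e : expr) (Q : state -> Prop) (t : nat).

(** A timed Hoare triple for total correctness of query-free commands. The time is only an upper
    bound, so that costs can be rounded up freely. *)
Definition runs s c t Q : Prop :=
  exists s' t', [/\ exec W input oracle s c s' t' [::], t' <= t & Q s'].

Lemma runs_weaken s c t t' Q Q' :
  runs s c t Q -> t <= t' -> (forall s', Q s' -> Q' s') -> runs s c t' Q'.
Proof.
move=> [s' [u [E le_u Qs']]] le_t QQ'; exists s', u.
by split; [ | exact: leq_trans le_t | exact: QQ'].
Qed.

Lemma runs_skip s t Q : 0 < t -> Q s -> runs s CSkip t Q.
Proof. by move=> t0 Qs; exists s, 1; split => //; constructor. Qed.

Lemma runs_assign s x e v t Q :
  eval W input s e = Some v -> expr_cost e < t -> Q (set_reg s x v) ->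
  runs s (CAssign x e) t Q.
Proof.
move=> Ev le_t Qs; exists (set_reg s x v), (expr_cost e).+1.
by split => //; constructor.
Qed.

Lemma runs_seq s c1 c2 t1 t2 t Q1 Q :
  runs s c1 t1 Q1 -> (forall s1, Q1 s1 -> runs s1 c2 t2 Q) -> t1 + t2 <= t ->
  runs s (CSeq c1 c2) t Q.
Proof.
move=> [s1 [u1 [E1 le1 Qs1]]] H le_t; have [s2 [u2 [E2 le2 Q2]]] := H _ Qs1.
exists s2, (u1 + u2); split=> //; last by apply: leq_trans le_t; apply: leq_add.
by rewrite -[[::]]cats0; apply: ExecSeq E1 E2.
Qed.

Lemma runs_assign_seq s x e v c t t' Q :
  eval W input s e = Some v -> runs (set_reg s x v) c t' Q ->
  (expr_cost e).+1 + t' <= t -> runs s (CSeq (CAssign x e) c) t Q.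
Proof.
move=> Ev Rc; apply: (@runs_seq _ _ _ _ _ _ (fun s' => s' = set_reg s x v)).
  exact: runs_assign Ev _ _.
by move=> s1 ->.
Qed.

Lemma runs_if s e c1 c2 v t t' Q :
  eval W input s e = Some v -> runs s (if v != 0 then c1 else c2) t' Q ->
  (expr_cost e).+1 + t' <= t -> runs s (CIf e c1 c2) t Q.
Proof.
move=> Ev [s' [u [E le_u Qs']]] le_t; exists s', ((expr_cost e).+1 + u).
split=> //; first by apply: ExecIf Ev E.
by apply: leq_trans le_t; rewrite leq_add2l.
Qed.

(** The number of iterations is fixed in advance and the invariant carries the iteration index, so
    each iteration may have its own cost. The induction is on the number of iterations left. *)
Lemma runs_while (I : nat -> state -> Prop) e c (N : nat) (tb : nat -> nat) :
  (forall k s, k < N -> I k s ->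
     (exists v, eval W input s e = Some v.+1) /\ runs s c (tb k) (I k.+1)) ->
  (forall s, I N s -> eval W input s e = Some 0) ->
  forall s t, I 0 s ->
  \sum_(k < N) ((expr_cost e).+1 + tb k) + (expr_cost e).+1 <= t ->
  runs s (CWhile e c) t (I N).
Proof.
move=> step stop s t I0 le_t.
suff H m : m <= N -> forall s, I (N - m) s -> runs s (CWhile e c)
    (\sum_(N - m <= k < N) ((expr_cost e).+1 + tb k) + (expr_cost e).+1) (I N).
  have := H N (leqnn N) s; rewrite subnn big_mkord => /(_ I0) HN.
  exact: runs_weaken HN le_t _.
elim: m => [|m IHm] le_m {t I0 le_t}s Is.
  rewrite subn0 big_geq // add0n; rewrite subn0 in Is.
  by exists s, (expr_cost e).+1; split=> //; apply: ExecWhileEnd (stop _ Is).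
have [[v Ev] [s1 [u1 [E1 le1 I1]]]] := step (N - m.+1) s ltac:(lia) Is.
have Nm : (N - m.+1).+1 = N - m by lia.
rewrite Nm in I1; have [s2 [u2 [E2 le2 I2]]] := IHm ltac:(lia) s1 I1.
exists s2, ((expr_cost e).+1 + u1 + u2); split=> //.
  by rewrite -[[::]]cats0; apply: ExecWhileStep Ev E1 E2.
by rewrite big_ltn ?Nm -?addnA; [lia | lia].
Qed.

Lemma eval_lit s k : k < W -> eval W input s (ELit k) = Some k.
Proof. by rewrite /= /word => ->. Qed.

Lemma eval_reg s x : regs s x < W -> eval W input s (EReg x) = Some (regs s x).
Proof. by rewrite /= /word => ->. Qed.

Lemma eval_bin s o e1 e2 x y :
  eval W input s e1 = Some x -> eval W input s e2 = Some y ->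
  binop_sem o x y < W ->
  eval W input s (EBin o e1 e2) = Some (binop_sem o x y).
Proof. by rewrite /= => -> ->; rewrite /word => ->. Qed.

Lemma eval_sym s e i v :
  eval W input s e = Some i.+1 -> onth input i = Some v -> v < W ->
  eval W input s (ESym e) = Some v.
Proof. by rewrite /= => -> -> /=; rewrite /word => ->. Qed.

Lemma eval_eq s e v v' :
  eval W input s e = Some v -> v = v' -> eval W input s e = Some v'.
Proof. by move=> ? <-. Qed.

End Runs.

Ltac eval_steps :=
  lazymatch goal with
  | |- eval _ _ _ (ELit _) = _ => eapply eval_lit
  | |- eval _ _ _ (EReg _) = _ => eapply eval_reg
  | |- eval _ _ _ (EBin _ _ _) = _ =>
      eapply eval_bin; [eval_steps | eval_steps | ]
  end.

Ltac eval_tac := eapply eval_eq; [eval_steps | ]; rewrite /=; try lia.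

(** The frame condition. Memory is left out because the programs below work in registers only. *)
Definition same_off (xs : seq nat) (s s' : state) : Prop :=
  forall x, x \notin xs -> regs s' x = regs s x.

Lemma same_off_trans xs s1 s2 s3 :
  same_off xs s1 s2 -> same_off xs s2 s3 -> same_off xs s1 s3.
Proof. by move=> H1 H2 x Hx; rewrite H2 // H1. Qed.

Lemma same_off_sub xs ys s1 s2 :
  {subset xs <= ys} -> same_off xs s1 s2 -> same_off ys s1 s2.
Proof. by move=> sub H x Hx; apply: H; apply: contra Hx; apply: sub. Qed.

Lemma same_off_set xs s x v : x \in xs -> same_off xs s (set_reg s x v).
Proof. by move=> Hx y Hy /=; rewrite /upd; case: eqP Hy => // ->; rewrite Hx. Qed.

(** * The two programs *)

Local Notation rI := 2 (only parsing).
Local Notation rQ := 3 (only parsing).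
Local Notation rB := 4 (only parsing).
Local Notation rT := 5 (only parsing).
Local Notation rF := 6 (only parsing).
Local Notation rM := 7 (only parsing).
Local Notation rLen := 8 (only parsing).
Local Notation rE := 9 (only parsing).
Local Notation rFound := 10 (only parsing).
Local Notation rD := 11 (only parsing).
Local Notation rP := 12 (only parsing).
Local Notation rG := 13 (only parsing).
Local Notation rPer := 14 (only parsing).

Local Notation add := (EBin OpAdd).
Local Notation sub := (EBin OpSub).
Local Notation "c1 ;; c2" := (CSeq c1 c2) (at level 60, right associativity).

(* Leaves [rT = rB] if the two windows of length [rB] agree, [rT = rB + 1] if not. *)
Definition compare_cmd : cmd :=
  CAssign rT (ELit 0) ;;
  CWhile (EBin OpLt (EReg rT) (EReg rB))
    (CIf (EBin OpEq (ESym (add (EReg rI) (EReg rT)))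
                    (ESym (add (add (EReg rI) (EReg rQ)) (EReg rT))))
       (CAssign rT (add (EReg rT) (ELit 1)))
       (CAssign rT (add (EReg rB) (ELit 1)))).

Definition find_border_cmd : cmd :=
  CAssign rB (ELit 1) ;;
  CAssign rF (ELit 0) ;;
  CWhile (EBin OpLt (EReg rB) (add (EReg rM) (ELit 1)))
    (CAssign rQ (sub (EReg rLen) (EReg rB)) ;;
     compare_cmd ;;
     CIf (EBin OpEq (EReg rT) (EReg rB)) (CAssign rF (ELit 1)) CSkip ;;
     CAssign rB (add (EReg rB) (ELit 1))).

(** [rE] is the number of symbols missing from the factor, so a factor of length [rLen] has [rE + 1]
    possible starting positions. *)
Definition find_unbordered_cmd : cmd :=
  CAssign rI (ELit 1) ;;
  CWhile (EBin OpLt (EReg rI) (add (EReg rE) (ELit 2)))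
    (find_border_cmd ;;
     CIf (EReg rF) CSkip (CAssign rFound (ELit 1)) ;;
     CAssign rI (add (EReg rI) (ELit 1))).

(** As long as [rE] is at most the margin [rD], every factor tried contains the queried one and its
    period limits the border lengths to test. Beyond the margin, all proper lengths are tested; this
    is slow but rare. *)
Definition search_cmd : cmd :=
  CAssign rE (ELit 0) ;;
  CAssign rFound (ELit 0) ;;
  CWhile (EBin OpEq (EReg rFound) (ELit 0))
    (CAssign rLen (sub (EReg 0) (EReg rE)) ;;
     CIf (EBin OpLt (EReg rD) (EReg rE))
       (CAssign rM (sub (EReg rLen) (ELit 1)))
       (CAssign rM (sub (EReg rLen) (EReg rPer))) ;;
     find_unbordered_cmd ;;
     CIf (EReg rFound) CSkip (CAssign rE (add (EReg rE) (ELit 1)))) ;;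
  CAssign 0 (sub (EReg 0) (EReg rE)).

Definition margin_cmd : cmd :=
  CAssign rG (ELit 0) ;;
  CAssign rP (ELit 1) ;;
  CWhile (EBin OpLt (EReg rP) (EReg 0))
    (CAssign rP (EBin OpMul (EReg rP) (EReg 1)) ;;
     CAssign rG (add (EReg rG) (ELit 1))) ;;
  (* 64 = 4 * 16: with w ^ 16 = sigma, w ^ (64 g) = sigma ^ (4 g) >= n ^ 4 pays for
     the crude bound [search_cost_crude]. *)
  CAssign rD (EBin OpMul (ELit 64) (EReg rG)) ;;
  CIf (EBin OpLt (EBin OpDiv (sub (EReg 0) (ELit 1)) (ELit 2)) (EReg rD))
    (CAssign rD (EBin OpDiv (sub (EReg 0) (ELit 1)) (ELit 2)))
    CSkip.

Definition L_from_per_cmd : cmd :=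
  margin_cmd ;;
  CQuery rPer (add (EReg rD) (ELit 1)) (sub (EReg 0) (EReg rD)) ;;
  search_cmd.

(** [rQ] starts at [L S], which is at most the period, so the first candidate that passes is the
    least period. *)
Definition search_period_cmd : cmd :=
  CAssign rI (ELit 1) ;;
  CAssign rFound (ELit 0) ;;
  CWhile (EBin OpEq (EReg rFound) (ELit 0))
    (CAssign rB (sub (EReg 0) (EReg rQ)) ;;
     compare_cmd ;;
     CIf (EBin OpEq (EReg rT) (EReg rB))
       (CAssign rFound (ELit 1))
       (CAssign rQ (add (EReg rQ) (ELit 1)))) ;;
  CAssign 0 (EReg rQ).

(** The unary alphabet is treated apart: there the period is 1, but checking it would take a linear
    number of comparisons for every string. *)
Definition per_from_L_cmd : cmd :=
  CQuery rQ (ELit 1) (EReg 0) ;;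
  CIf (EBin OpEq (EReg 1) (ELit 1)) (CAssign 0 (ELit 1)) search_period_cmd.

(** * Correctness and running time for a given string *)

Section Programs.
Variables (Sigma : finType) (S : seq Sigma) (W : nat) (oracle : nat -> nat -> nat).
Local Notation n := (size S).
Local Notation sigma := #|Sigma|.
Local Notation input := [seq nat_of_ord (enum_rank a) | a <- S].
Hypothesis W_big : 16 * (n + sigma) <= W.
Hypothesis n_gt0 : 0 < n.
Local Notation runs := (runs W input oracle).

Lemma eval_input s e k : eval W input s e = Some k.+1 -> k < n ->
  exists2 a, onth S k = Some a &
    eval W input s (ESym e) = Some (nat_of_ord (enum_rank a)).
Proof.
move=> Ee lt_k; have : onth S k by rewrite onthTE.
case Ek: (onth S k) => [a|] // _; exists a => //.
apply: eval_sym Ee _ _; first by rewrite onth_map Ek.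
have le_W : sigma <= W by lia.
exact: leq_trans (ltn_ord _) le_W.
Qed.

Lemma compare_runs a q b s :
  regs s rI = a.+1 -> regs s rQ = q -> regs s rB = b -> a + q + b <= n ->
  runs s compare_cmd (30 * (1 + agree_len S a q b))
    (fun s' => same_off [:: rT] s s' /\
               regs s' rT = if agree S a q b then b else b.+1).
Proof.
move=> EI EQ EB le_n; set M := agree_len S a q b.
have le_M : M <= b := agree_len_leq S a q b.
set N := M + (M < b).
apply: (@runs_assign_seq _ _ _ _ _ _ 0 _ _ (30 * (1 + M) - 2));
  [by eval_tac | | by rewrite /=; lia].
set s1 := set_reg _ _ _.
pose Inv k s' := same_off [:: rT] s s' /\ regs s' rT = if k <= M then k else b.+1.
apply: (@runs_weaken _ _ _ _ _ (30 * (1 + M) - 2) _ (Inv N)) => //; last first.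
  move=> s' [F ->]; split => //; rewrite -agree_len_eq -/M /N.
  by case: (ltngtP M b) le_M => //= [lt _|->]; rewrite ?addn1 ?ltnn ?addn0 ?leqnn.
apply: (@runs_while _ _ _ Inv _ _ N (fun=> 16)).
- move=> k s' lt_k [F ET].
  have EI' := F rI isT; have EQ' := F rQ isT; have EB' := F rB isT.
  have le_k : k <= M by move: lt_k; rewrite /N; lia.
  rewrite le_k in ET.
  have lt_kb : k < b by move: lt_k; rewrite /N; lia.
  split; first by exists 0; eval_tac.
  have [|a1 Ea1 Ev1] := @eval_input s' (add (EReg rI) (EReg rT)) (a + k) _ ltac:(lia).
    by eval_tac.
  have [|a2 Ea2 Ev2] :=
    @eval_input s' (add (add (EReg rI) (EReg rQ)) (EReg rT)) (a + q + k) _ ltac:(lia).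
    by eval_tac.
  have Ev := @eval_bin W input s' OpEq _ _ _ _ Ev1 Ev2.
  apply: (@runs_if _ _ _ _ _ _ _ _ _ 4); first apply: Ev; last by [].
    by rewrite /=; lia.
  have -> : binop_sem OpEq (enum_rank a1) (enum_rank a2) = (k < M) :> nat.
    rewrite /= (inj_eq val_inj) (inj_eq enum_rank_inj).
    have [lt_kM | ge_kM] := ltnP k M.
      have /agreeP/(_ k lt_kM) := agree_leq_len (leqnn M : M <= agree_len S a q b).
      by rewrite Ea1 Ea2 => -[->]; rewrite eqxx.
    have Ek : k = M by apply/eqP; rewrite eqn_leq le_k.
    have /agree_len_neq : agree_len S a q b < b by rewrite -/M -Ek.
    rewrite -/M -Ek Ea1 Ea2 => /negP H.
    by case: eqP => // E12; case: H; rewrite E12.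
  case: ltnP => [lt_kM | ge_kM] /=.
    apply: (@runs_assign _ _ _ _ _ _ k.+1) => //; first by eval_tac.
    split; first by apply: same_off_trans F _; apply: same_off_set.
    by rewrite /= lt_kM.
  apply: (@runs_assign _ _ _ _ _ _ b.+1) => //; first by eval_tac.
  split; first by apply: same_off_trans F _; apply: same_off_set.
  by rewrite /= ltnNge ge_kM.
- move=> s' [F ET]; have EB' := F rB isT.
  have ET' : b <= regs s' rT <= b.+1 by rewrite ET /N; case: ifP; lia.
  by eval_tac.
- by split=> //; apply: same_off_set.
- rewrite /= sum_nat_const card_ord /N; case: (M < b); lia.
Qed.

Definition short_border a l m : bool :=
  has (fun b => agree S a (l - b) b) (iota 1 m).

Lemma find_border_runs a l m s :
  regs s rI = a.+1 -> regs s rLen = l -> regs s rM = m ->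
  m <= l -> a + l <= n ->
  runs s find_border_cmd (60 * \sum_(b < m.+1) (1 + agree_len S a (l - b) b))
    (fun s' => same_off [:: rQ; rB; rT; rF] s s' /\
               regs s' rF = short_border a l m).
Proof.
move=> EI El Em le_m le_n; set t := _ * _.
(* The term [b = 0] of the sum equals 1; it pays for the initialization and the last loop test. *)
have Et : t = 60 + 60 * \sum_(k < m) (1 + agree_len S a (l - k.+1) k.+1).
  by rewrite /t big_ord_recl mulnDr.
apply: (@runs_assign_seq _ _ _ _ _ _ 1 _ _ (t - 2));
  [by eval_tac | | by rewrite /=; lia].
apply: (@runs_assign_seq _ _ _ _ _ _ 0 _ _ (t - 4));
  [by eval_tac | | by rewrite /=; lia].
pose Inv k s' := [/\ same_off [:: rQ; rB; rT; rF] s s', regs s' rB = k.+1 &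
  regs s' rF = short_border a l k].
apply: (@runs_weaken _ _ _ _ _ (t - 4) _ (Inv m)) => //; last first.
  by move=> s' [F _ ->].
apply: (@runs_while _ _ _ Inv _ _ m
          (fun k => 20 + 30 * (1 + agree_len S a (l - k.+1) k.+1))).
- move=> k s' lt_k [F EB EF].
  have EI' := F rI isT; have El' := F rLen isT; have Em' := F rM isT.
  split; first by exists 0; eval_tac.
  apply: (@runs_assign_seq _ _ _ _ _ _ (l - k.+1) _ _
    (14 + 30 * (1 + agree_len S a (l - k.+1) k.+1)));
    [by eval_tac | | by rewrite /=; lia].
  apply: (@runs_seq _ _ _ _ _ _ (30 * (1 + agree_len S a (l - k.+1) k.+1)) 14);
    [apply: compare_runs; rewrite //=; lia | | by rewrite addnC].
  move=> s1 [F1 ET1].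
  have EB1 := F1 rB isT; have EF1 := F1 rF isT.
  rewrite /= in EB1 EF1.
  pose Q s' := same_off [:: rQ; rB; rT; rF] s1 s' /\ regs s' rB = k.+1 /\
    regs s' rF = short_border a l k.+1.
  have Esb : short_border a l k.+1 = short_border a l k || agree S a (l - k.+1) k.+1.
    have Ek : iota 1 k.+1 = iota 1 k ++ [:: k.+1].
      by rewrite -(addn1 k) iotaD add1n addn1.
    by rewrite /short_border Ek has_cat /= orbF.
  apply: (@runs_seq _ _ _ _ _ _ 7 5 _ Q) => //.
    apply: (@runs_if _ _ _ _ _ _ _ (agree S a (l - k.+1) k.+1) _ 3) => //.
      by case: agree ET1 => ET1; eval_tac.
    rewrite /Q Esb; case: agree => /=.
      apply: (@runs_assign _ _ _ _ _ _ 1) => //; first by eval_tac.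
      by split; [apply: same_off_set | split; rewrite //= ?orbT ?EB1].
    apply: runs_skip => //; split => //; split; first by rewrite EB1.
    by rewrite orbF EF1.
  move=> s2 [F2 [EB2 EF2]].
  apply: (@runs_assign _ _ _ _ _ _ k.+2) => //; first by eval_tac.
  split; rewrite //=; apply: same_off_trans F _.
  apply: (@same_off_trans _ _ s1); last first.
    by apply: same_off_trans F2 _; apply: same_off_set.
  apply: (@same_off_trans _ _ (set_reg s' rQ (l - k.+1))).
    exact: same_off_set.
  by apply: same_off_sub F1 => x; rewrite !inE => ->; rewrite ?orbT.
- move=> s' [F EB EF]; have Em' := F rM isT.
  by eval_tac.
- by split=> //; apply: (@same_off_trans _ _ (set_reg s rB 1)); apply: same_off_set.
- have le_X : \sum_(k < m) (6 + (20 + 30 * (1 + agree_len S a (l - k.+1) k.+1))) <=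
      60 * \sum_(k < m) (1 + agree_len S a (l - k.+1) k.+1).
    by rewrite big_distrr /=; apply: leq_sum => k _; lia.
  by apply: leq_trans (leq_add le_X (leqnn 6)) _; lia.
Qed.

Lemma find_unbordered_runs e l m s :
  regs s rE = e -> regs s rLen = l -> regs s rM = m -> regs s rFound = 0 ->
  m <= l -> e + l <= n ->
  runs s find_unbordered_cmd
    (90 * \sum_(a < e.+1) \sum_(b < m.+1) (1 + agree_len S a (l - b) b))
    (fun s' => same_off [:: rI; rQ; rB; rT; rF; rFound] s s' /\
       regs s' rFound = has (fun a => ~~ short_border a l m) (iota 0 e.+1)).
Proof.
move=> EE El Em Efd le_m le_n.
pose c a := \sum_(b < m.+1) (1 + agree_len S a (l - b) b).
have c_gt0 a : 0 < c a by rewrite /c big_ord_recl.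
rewrite -/(c _); set t := _ * _.
have c_sum : 0 < \sum_(a < e.+1) c a by rewrite big_ord_recl ltn_addr.
have le_X : \sum_(a < e.+1) (6 + (60 * c a + 10)) <= 76 * \sum_(a < e.+1) c a.
  by rewrite big_distrr /=; apply: leq_sum => a _; have := c_gt0 a; lia.
have Et : t = 90 * \sum_(a < e.+1) c a by [].
apply: (@runs_assign_seq _ _ _ _ _ _ 1 _ _ (t - 2));
  [by eval_tac | | by rewrite /=; lia].
pose xs := [:: rI; rQ; rB; rT; rF; rFound].
pose Inv k s' := [/\ same_off xs s s', regs s' rI = k.+1 &
  regs s' rFound = has (fun a => ~~ short_border a l m) (iota 0 k)].
apply: (@runs_weaken _ _ _ _ _ (t - 2) _ (Inv e.+1)) => //; last first.
  by move=> s' [F _ ->].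
apply: (@runs_while _ _ _ Inv _ _ e.+1 (fun k => 60 * c k + 10)).
- move=> k s' lt_k [F EI Efd'].
  have EE' := F rE isT; have El' := F rLen isT; have Em' := F rM isT.
  split; first by exists 0; eval_tac.
  apply: (@runs_seq _ _ _ _ _ _ (60 * c k) 10) => //.
    by apply: find_border_runs; rewrite //=; lia.
  move=> s1 [F1 EF1].
  have EI1 := F1 rI isT; have Efd1 := F1 rFound isT.
  have Eh : has (fun a => ~~ short_border a l m) (iota 0 k.+1) =
      has (fun a => ~~ short_border a l m) (iota 0 k) || ~~ short_border k l m.
    have Ek : iota 0 k.+1 = iota 0 k ++ [:: k] by rewrite -(addn1 k) iotaD.
    by rewrite Ek has_cat /= orbF.
  pose Q s' := same_off xs s1 s' /\ regs s' rI = k.+1 /\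
    regs s' rFound = has (fun a => ~~ short_border a l m) (iota 0 k.+1).
  apply: (@runs_seq _ _ _ _ _ _ 5 5 _ Q) => //.
    apply: (@runs_if _ _ _ _ _ _ _ (short_border k l m) _ 3) => //.
      by case: short_border EF1 => EF1; eval_tac.
    rewrite /Q Eh; case: short_border => /=.
      apply: runs_skip => //; split => //; split; first by rewrite EI1.
      by rewrite orbF Efd1.
    apply: (@runs_assign _ _ _ _ _ _ 1) => //; first by eval_tac.
    by split; [apply: same_off_set | split; rewrite //= ?orbT ?EI1].
  move=> s2 [F2 [EI2 EF2]].
  apply: (@runs_assign _ _ _ _ _ _ k.+2) => //; first by eval_tac.
  split; rewrite //=; apply: same_off_trans F _.
  apply: (@same_off_trans _ _ s1); last first.
    by apply: same_off_trans F2 _; apply: same_off_set.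
  by apply: same_off_sub F1 => x; rewrite !inE => /or4P[] ->; rewrite ?orbT.
- move=> s' [F EI _]; have EE' := F rE isT.
  by eval_tac.
- by split=> //; apply: same_off_set.
- by apply: leq_trans (leq_add le_X (leqnn 6)) _; lia.
Qed.

Section Search.
Variable d : nat.
Hypothesis d_small : d + d < n.
Local Notation p := (per (factor S d.+1 (n - d))).

(** For [e <= d], a longer border would give the queried factor a period smaller than [p]. *)
Definition border_bound e : nat := if d < e then n - e - 1 else n - e - p.

(** The sums mirror the three nested loops. The outer one ends at [e = n - L S], the first round in
    which an unbordered factor exists. *)
Definition search_cost : nat :=
  \sum_(e < (n - L S).+1) \sum_(a < e.+1) \sum_(b < (border_bound e).+1)
    (1 + agree_len S a (n - e - b) b).

(** When [e <= d], the factor starts at [a <= d] and ends at [a + (n - e) >= n - d], so it contains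
    the queried factor. A border of length [b] then gives that factor the period [n - e - b], whence
    [b <= n - e - p]: no border escapes the test. *)
Lemma short_borderN a e : a <= e -> e < n ->
  ~~ short_border a (n - e) (border_bound e) <->
  unbordered (factor S a.+1 (a + (n - e))).
Proof.
move=> le_ae lt_en; have le_n : a + (n - e) <= n by lia.
apply: iff_trans (iff_sym (unbordered_factorP le_n)).
have p0 : 0 < p := per_gt0 _.
split=> [/hasPn H b Hb | H]; last first.
  apply/hasPn => b; rewrite mem_iota /border_bound => Hb; apply: H.
  by move: Hb; case: ifP; lia.
apply/negP => Ab; suff : b \in iota 1 (border_bound e) by move/H; rewrite Ab.
rewrite mem_iota /border_bound; case: ifP => [|/negbT]; first lia.
rewrite -leqNgt => le_ed.
have /per_leq : period (factor S d.+1 (n - d)) (n - e - b); last by lia.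
have Hd : d < n - d <= n by lia.
by apply: (period_factor Hd Ab); lia.
Qed.

Lemma has_unborderedE e : e < (n - L S).+1 ->
  has (fun a => ~~ short_border a (n - e) (border_bound e)) (iota 0 e.+1) =
  (e == n - L S).
Proof.
move=> le_e; have L0 := L_gt0 n_gt0; have Ln : L S <= n := L_leq_size S.
apply/hasP/eqP => [[a] | Ee].
  rewrite mem_iota => lt_a /short_borderN => /(_ ltac:(lia) ltac:(lia)) U.
  have l0 : 0 < n - e by lia.
  have le_n : a + (n - e) <= n by lia.
  by have := L_geq l0 le_n U; lia.
have [i [le_i U]] := L_attained n_gt0.
have {}le_i : i + L S <= n := le_i.
exists i; first by rewrite mem_iota; lia.
apply/short_borderN; [lia | lia | ].
by have -> : n - e = L S by lia.
Qed.

Lemma search_runs s :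
  regs s 0 = n -> regs s rD = d -> regs s rPer = p ->
  runs s search_cmd (150 * search_cost) (fun s' => regs s' 0 = L S).
Proof.
move=> E0 ED EP; have L0 := L_gt0 n_gt0; have Ln : L S <= n := L_leq_size S.
have p0 : 0 < p := per_gt0 _.
have pn : p <= n.
  have le_nd : n - d <= n by lia.
  have sz : size (factor S d.+1 (n - d)) = n - d - d by rewrite size_factor.
  by apply: leq_trans (per_leq_size _) _; rewrite sz; lia.
rewrite /search_cost; set N := (n - L S).+1.
pose c e := \sum_(a < e.+1) \sum_(b < (border_bound e).+1)
  (1 + agree_len S a (n - e - b) b).
have c_gt0 e : 0 < c e by rewrite /c big_ord_recl big_ord_recl.
rewrite -/(c _); set t := _ * _.
have c_sum : 0 < \sum_(e < N) c e by rewrite big_ord_recl ltn_addr.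
have le_X : \sum_(e < N) (4 + (18 + 90 * c e)) <= 112 * \sum_(e < N) c e.
  by rewrite big_distrr /=; apply: leq_sum => e _; have := c_gt0 e; lia.
have Et : t = 150 * \sum_(e < N) c e by [].
apply: (@runs_assign_seq _ _ _ _ _ _ 0 _ _ (t - 2));
  [by eval_tac | | by rewrite /=; lia].
apply: (@runs_assign_seq _ _ _ _ _ _ 0 _ _ (t - 4));
  [by eval_tac | | by rewrite /=; lia].
pose xs := [:: rI; rQ; rB; rT; rF; rM; rLen; rE; rFound].
(* The successful round sets [rFound] without advancing [rE], hence the minimum. *)
pose Inv k s' := [/\ same_off xs s s', regs s' rE = minn k (n - L S) &
  regs s' rFound = (n - L S < k)].
apply: (@runs_seq _ _ _ _ _ _ (t - 8) 4 _ (Inv N)); last 2 first.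
- move=> s' [F EE Efd]; have E0' := F 0 isT.
  rewrite minnE in EE.
  by apply: (@runs_assign _ _ _ _ _ _ (L S)) => //; eval_tac.
- by lia.
apply: (@runs_while _ _ _ Inv _ _ N (fun k => 18 + 90 * c k)).
- move=> k s' lt_k [F EE Efd].
  have E0' := F 0 isT; have ED' := F rD isT; have EP' := F rPer isT.
  have {}EE : regs s' rE = k by rewrite EE; apply/minn_idPl; lia.
  have {}Efd : regs s' rFound = 0 by rewrite Efd; lia.
  split; first by exists 0; eval_tac.
  apply: (@runs_assign_seq _ _ _ _ _ _ (n - k) _ _ (14 + 90 * c k));
    [by eval_tac | | by rewrite /=; lia].
  set s1 := set_reg _ _ _.
  have F1 : same_off xs s' s1 by apply: same_off_set.
  pose Q s2 := same_off [:: rM] s1 s2 /\ regs s2 rM = border_bound k.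
  apply: (@runs_seq _ _ _ _ _ _ 8 (6 + 90 * c k) _ Q); last by lia.
    apply: (@runs_if _ _ _ _ _ _ _ (d < k) _ 4) => //; first by eval_tac.
    have EQ : Q (set_reg s1 rM (border_bound k)) by split=> //; apply: same_off_set.
    rewrite /border_bound in EQ.
    case: ltnP EQ => _ EQ /=.
      by apply: (@runs_assign _ _ _ _ _ _ (n - k - 1)) => //; eval_tac.
    by apply: (@runs_assign _ _ _ _ _ _ (n - k - p)) => //; eval_tac.
  move=> s2 [F2 EM2].
  have EE2 := F2 rE isT; have El2 := F2 rLen isT; have Efd2 := F2 rFound isT.
  rewrite /= in EE2 El2 Efd2.
  have le_b : border_bound k <= n - k by rewrite /border_bound; case: ifP; lia.
  apply: (@runs_seq _ _ _ _ _ _ (90 * c k) 6); last by lia.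
    by apply: find_unbordered_runs; rewrite //=; lia.
  move=> s3 [F3]; rewrite has_unborderedE // => Efd3.
  have EE3 := F3 rE isT.
  have F13 : same_off xs s s3.
    apply: same_off_trans F _; apply: same_off_trans F1 _.
    apply: (@same_off_trans _ _ s2).
      by apply: same_off_sub F2 => x; rewrite !inE => ->; rewrite ?orbT.
    apply: same_off_sub F3 => x; rewrite !inE.
    by do 5?[case/orP => [->|]; rewrite ?orbT //]; move=> ->; rewrite ?orbT.
  apply: (@runs_if _ _ _ _ _ _ _ (k == n - L S) _ 4) => //.
    by case: (k == _) Efd3 => Efd3; eval_tac.
  case: eqP Efd3 => [Ek|nk] /= Efd3.
    apply: runs_skip => //; split=> //; last by rewrite Efd3 -Ek leqnn.
    by rewrite EE3 EE2 EE; lia.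
  apply: (@runs_assign _ _ _ _ _ _ k.+1) => //; first by eval_tac.
  split=> //=; last by rewrite Efd3; lia.
  - by apply: same_off_trans F13 _; apply: same_off_set.
  - by lia.
- move=> s' [F _ Efd].
  have {}Efd : regs s' rFound = 1 by rewrite Efd ltnSn.
  by eval_tac.
- split=> //=; last by rewrite min0n.
  by apply: (@same_off_trans _ _ (set_reg s rE 0)); apply: same_off_set.
- by apply: leq_trans (leq_add le_X (leqnn 4)) _; lia.
Qed.

End Search.

(** The loop multiplies by [sigma] exactly [up_log sigma n] times, and only while the power is below
    [n]; all powers therefore stay below [n * sigma] and fit into a word. *)
Lemma margin_runs s g : g = up_log sigma n ->
  1 < sigma -> 128 * (n + sigma) <= W -> n * sigma < W ->
  regs s 0 = n -> regs s 1 = sigma ->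
  runs s margin_cmd (30 * g.+1)
    (fun s' => regs s' 0 = n /\ regs s' rD = minn (64 * g) ((n - 1) %/ 2)).
Proof.
move=> Eg s1 W128 WM E0 E1.
have le_ng : n <= sigma ^ g by rewrite Eg; apply: up_logP.
have gt_ng k : k < g -> sigma ^ k < n.
  by rewrite Eg !ltnNge; apply: contra; apply: up_log_min.
have g_le : g <= n.
  case Eg' : g => [|g'] //; have := gt_ng g'; rewrite Eg' => /(_ (leqnn _)).
  by apply: leq_ltn_trans; apply/ltnW/ltn_expl.
apply: (@runs_assign_seq _ _ _ _ _ _ 0 _ _ (28 + 12 * g));
  [by eval_tac | | by rewrite /=; lia].
apply: (@runs_assign_seq _ _ _ _ _ _ 1 _ _ (26 + 12 * g));
  [by eval_tac | | by rewrite /=; lia].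
pose Inv k s' := [/\ same_off [:: rP; rG] s s', regs s' rP = sigma ^ k &
  regs s' rG = k].
apply: (@runs_seq _ _ _ _ _ _ (4 + 12 * g) 22 _ (Inv g)); last by lia.
- apply: (@runs_while _ _ _ Inv _ _ g (fun=> 8)).
  + move=> k s' lt_k [F EP EG].
    have E0' := F 0 isT; have E1' := F 1 isT; have lt_n := gt_ng k lt_k.
    have lt_W : sigma ^ k * sigma < W.
      by apply: leq_ltn_trans WM; apply: leq_mul => //; apply: ltnW.
    split; first by exists 0; eval_tac.
    apply: (@runs_assign_seq _ _ _ _ _ _ (sigma ^ k.+1) _ _ 4) => //.
      by eval_tac; rewrite ?EP ?E1' ?E1 // expnSr.
    apply: (@runs_assign _ _ _ _ _ _ k.+1) => //; first by eval_tac.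
    split=> //; apply: same_off_trans F _.
    by apply: (@same_off_trans _ _ (set_reg s' rP (sigma ^ k.+1))); apply: same_off_set.
  + move=> s' [F EP EG]; have E0' := F 0 isT.
    have lt_W : sigma ^ g < W.
      case Eg' : g => [|g']; first by rewrite expn0; lia.
      rewrite expnSr; apply: leq_ltn_trans WM; apply: leq_mul => //.
      by apply/ltnW/gt_ng; rewrite Eg'.
    by eval_tac.
  + by split=> //; apply: (@same_off_trans _ _ (set_reg s rG 0)); apply: same_off_set.
  + by rewrite sum_nat_const card_ord /=; lia.
move=> s' [F EP EG]; have E0' := F 0 isT.
apply: (@runs_assign_seq _ _ _ _ _ _ (64 * g) _ _ 18) => //; first by eval_tac.
apply: (@runs_if _ _ _ _ _ _ _ ((n - 1) %/ 2 < 64 * g) _ 6) => //.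
  by eval_tac.
case: ltnP => lt_n /=; last first.
  by apply: runs_skip => //=; split; lia.
apply: (@runs_assign _ _ _ _ _ _ ((n - 1) %/ 2)) => //; first by eval_tac.
by split=> /=; lia.
Qed.

(** There are [per S - L S + 1] candidates, and each comparison covers at most [n - L S] symbols;
    both are at most [n - L S + 1], which gives the square. *)
Lemma search_period_runs s :
  regs s 0 = n -> regs s rQ = L S ->
  runs s search_period_cmd (80 * (n - L S).+1 ^ 2) (fun s' => regs s' 0 = per S).
Proof.
move=> E0 EQ; have L0 := L_gt0 n_gt0; have Ln : L S <= n := L_leq_size S.
have Lp : L S <= per S := L_leq_per S; have pn : per S <= n := per_leq_size n_gt0.
set N := (per S - L S).+1; set D := (n - L S).+1.
set t := 80 * _.
have le_X : \sum_(k < N) (4 + (12 + 30 * D)) <= 46 * D ^ 2.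
  rewrite sum_nat_const card_ord expnS expn1.
  have le_ND : N <= D by rewrite /N /D; lia.
  have D0 : 0 < D by [].
  apply: (@leq_trans (N * (46 * D))); first by apply: leq_mul; lia.
  by rewrite mulnCA leq_mul2l /= leq_mul2r le_ND orbT.
have D1 : 0 < D ^ 2 by rewrite expn_gt0.
apply: (@runs_assign_seq _ _ _ _ _ _ 1 _ _ (t - 2));
  [by eval_tac | | by rewrite /=; lia].
apply: (@runs_assign_seq _ _ _ _ _ _ 0 _ _ (t - 4));
  [by eval_tac | | by rewrite /=; lia].
pose xs := [:: rQ; rB; rT; rFound].
set s0 := set_reg _ _ _.
pose Inv k s' := [/\ same_off xs s0 s', regs s' rQ = minn (L S + k) (per S) &
  regs s' rFound = (per S - L S < k)].
apply: (@runs_seq _ _ _ _ _ _ (t - 8) 2 _ (Inv N)); last 2 first.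
- move=> s' [F {}EQ _].
  have {}EQ : regs s' rQ = per S by rewrite EQ; apply/minn_idPr; lia.
  by apply: (@runs_assign _ _ _ _ _ _ (per S)) => //; eval_tac.
- by lia.
apply: (@runs_while _ _ _ Inv _ _ N (fun=> 12 + 30 * D)).
- move=> k s' lt_k [F {}EQ Efd].
  have E0' := F 0 isT; have EI' := F rI isT; rewrite /= in E0' EI'.
  have {}EQ : regs s' rQ = L S + k by rewrite EQ; apply/minn_idPl; lia.
  have {}Efd : regs s' rFound = 0 by rewrite Efd; lia.
  split; first by exists 0; eval_tac.
  apply: (@runs_assign_seq _ _ _ _ _ _ (n - (L S + k)) _ _ (8 + 30 * D));
    [by eval_tac | | by rewrite /=; lia].
  set q := L S + k in EQ *; set b := n - q.
  have le_len : agree_len S 0 q b <= b by apply: agree_len_leq.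
  apply: (@runs_seq _ _ _ _ _ _ (30 * (1 + agree_len S 0 q b)) 8);
    [apply: compare_runs; rewrite //=; lia | | lia].
  move=> s1 [F1 ET1].
  have EB1 := F1 rB isT; have EQ1 := F1 rQ isT; rewrite /= in EB1 EQ1.
  have Ea : agree S 0 q b = (q == per S).
    have -> : agree S 0 q b = period S q by rewrite periodP /q ltn_addr.
    apply/idP/eqP => [/per_leq le_pq | ->]; last exact: perP.
    by apply/eqP; rewrite eqn_leq le_pq andbT /q; lia.
  rewrite {}Ea in ET1.
  have F01 : same_off xs s0 s1.
    apply: same_off_trans F _.
    apply: (@same_off_trans _ _ (set_reg s' rB b)); first exact: same_off_set.
    by apply: same_off_sub F1 => x; rewrite !inE => ->; rewrite ?orbT.
  apply: (@runs_if _ _ _ _ _ _ _ (q == per S) _ 4) => //.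
    by case: (q == _) ET1 => ET1; eval_tac.
  case: (q =P per S) => [Eq|nq] /=.
    apply: (@runs_assign _ _ _ _ _ _ 1) => //; first by eval_tac.
    split; first by apply: same_off_trans F01 _; apply: same_off_set.
      by rewrite /= EQ1 EQ; apply/esym; rewrite minnE; lia.
    by rewrite /=; lia.
  apply: (@runs_assign _ _ _ _ _ _ q.+1) => //; first by eval_tac.
  split; first by apply: same_off_trans F01 _; apply: same_off_set.
    by rewrite /= addnS; apply/esym/minn_idPl; rewrite -/q; lia.
  have Efd1 : regs s1 rFound = regs s' rFound := F1 rFound isT.
  by rewrite /= Efd1 Efd; lia.
- move=> s' [F _ Efd].
  have {}Efd : regs s' rFound = 1 by rewrite Efd ltnSn.
  by eval_tac.
- by split=> //=; rewrite EQ addn0; apply/esym/minn_idPl.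
- by apply: leq_trans (leq_add le_X (leqnn 4)) _; lia.
Qed.

End Programs.

(** The cap [(n - 1) %/ 2] ensures [d + d < n], so the queried factor is never empty. *)
Lemma L_from_per_correct (Sigma : finType) (S : seq Sigma) :
  1 < #|Sigma| -> 0 < size S ->
  let n := size S in
  let g := up_log #|Sigma| n in
  let d := minn (64 * g) ((n - 1) %/ 2) in
  exists2 t, computes_with_query 6 L_from_per_cmd (@L Sigma) (@per Sigma) S
               d.+1 (n - d) t
           & t <= 200 * (g.+1 + search_cost S d).
Proof.
move=> s1 n0 n g d; rewrite /computes_with_query -/n.
set W := _ ^ _; set input := map _ S.
pose oracle i j := per (factor S i j); rewrite -/oracle.
(* Since [n + sigma >= 3], six of the seven factors of [W] contribute at least 3 ^ 6 = 729. *)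
have W729 : 729 * (n + #|Sigma|) <= W.
  rewrite /W expnSr leq_mul2r; apply/orP; right.
  by apply: (@leq_trans (3 ^ 6)) => //; rewrite leq_exp2r //; lia.
have WM : n * #|Sigma| < W.
  apply: (@leq_trans ((n + #|Sigma|) ^ 2)); last by rewrite leq_exp2l //; lia.
  by rewrite /=; nia.
clearbody W.
have W16 : 16 * (size S + #|Sigma|) <= W by move: W729; rewrite /n; lia.
have W128 : 128 * (size S + #|Sigma|) <= W by move: W729; rewrite /n; lia.
have d_small : d + d < size S by rewrite /d -/n; have := n0; rewrite -/n; lia.
have [sa [ta [Ea le_ta [E0 ED]]]] := @margin_runs Sigma S W oracle W16 n0
  (init_state n #|Sigma|) g erefl s1 W128 WM erefl erefl.
have [sb [tb [Eb le_tb EL]]] := @search_runs Sigma S W oracle W16 n0 d d_small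
  (set_reg sa rPer (oracle d.+1 (n - d))) E0 ED erefl.
rewrite -/n in E0; rewrite -/n -/d in ED.
exists (ta + (7 + tb)); last by lia.
exists sb; split=> //.
have -> : [:: (d.+1, n - d)] = [::] ++ ([:: (d.+1, n - d)] ++ [::]) by [].
apply: ExecSeq Ea _; apply: ExecSeq _ Eb.
apply: (@ExecQuery W input oracle sa rPer
  (add (EReg rD) (ELit 1)) (sub (EReg 0) (EReg rD)) d.+1 (n - d)).
- by eval_tac; move: W729; rewrite /n; lia.
- by eval_tac; move: W729; rewrite /n; lia.
- by rewrite /n; lia.
- by rewrite size_map /n; lia.
Qed.

Lemma per_unary (Sigma : finType) (S : seq Sigma) :
  #|Sigma| = 1 -> 0 < size S -> per S = 1.
Proof.
move=> s1 n0; apply/eqP; rewrite eqn_leq per_gt0 andbT; apply: per_leq.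
rewrite periodP /=; apply/agreeP => t lt_t.
have : onth S (0 + t) by rewrite onthTE; lia.
have : onth S (0 + 1 + t) by rewrite onthTE; lia.
case: onth => // x _; case: onth => // y _.
by have /fintype1[z Ez] := s1; rewrite (Ez x) (Ez y).
Qed.

Lemma per_from_L_correct (Sigma : finType) (S : seq Sigma) :
  0 < size S ->
  exists2 t, computes_with_query 6 per_from_L_cmd (@per Sigma) (@L Sigma) S
               1 (size S) t
           & t <= 100 * (if #|Sigma| == 1 then 1 else (size S - L S).+1 ^ 2).
Proof.
have s0 : 0 < size S -> 0 < #|Sigma|.
  by case: S => // a *; apply/card_gt0P; exists a.
move=> n0; have {}s0 := s0 n0; rewrite /computes_with_query.
set n := size S; set W := _ ^ _; set input := map _ S.
pose oracle i j := L (factor S i j); rewrite -/oracle.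
have W64 : 64 * (n + #|Sigma|) <= W.
  rewrite /W expnSr leq_mul2r; apply/orP; right.
  by apply: (@leq_trans (2 ^ 6)) => //; rewrite leq_exp2r //; lia.
clearbody W.
have W16 : 16 * (size S + #|Sigma|) <= W by move: W64; rewrite /n; lia.
have sW : #|Sigma| < W by lia.
pose s1 := set_reg (init_state n #|Sigma|) rQ (oracle 1 n).
have EL : oracle 1 n = L S by rewrite /oracle /factor take_size drop0.
have Eq : exec W input oracle (init_state n #|Sigma|) (CQuery rQ (ELit 1) (EReg 0))
    s1 3 [:: (1, n)].
  apply: (@ExecQuery W input oracle _ rQ (ELit 1) (EReg 0) 1 n).
  - by eval_tac.
  - by eval_tac.
  - by rewrite /n; lia.
  - by rewrite size_map.
have D1 : 0 < (n - L S).+1 ^ 2 by rewrite expn_gt0.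
pose B := if #|Sigma| == 1 then 1 else (n - L S).+1 ^ 2.
have [s2 [t2 [E2 le2 EP]]] : runs W input oracle s1
    (CIf (EBin OpEq (EReg 1) (ELit 1)) (CAssign 0 (ELit 1)) search_period_cmd)
    (90 * B) (fun s' => regs s' 0 = per S).
  apply: (@runs_if _ _ _ _ _ _ _ (#|Sigma| == 1) _ (80 * B)).
  - by rewrite /s1; eval_tac; apply: sW.
  - rewrite /B; case: (#|Sigma| =P 1) => [sig1|_] /=; last exact: search_period_runs.
    apply: (@runs_assign _ _ _ _ _ _ 1) => //; first by eval_tac.
    by rewrite per_unary.
  - by rewrite /= /B; case: ifP; lia.
exists (3 + t2); last by rewrite -/B; move: le2; rewrite /B; case: ifP; lia.
exists s2; split=> //.
by have -> : [:: (1, n)] = [:: (1, n)] ++ [::] by []; apply: ExecSeq Eq E2.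
Qed.

Local Open Scope ring_scope.

(** * Sums over all strings *)

Section TupleSum.
Variables (R : realType) (Sigma : finType).
Implicit Types (f g : seq Sigma -> R) (s u v : seq Sigma).
Local Notation N := (#|Sigma|%:R : R).

(** An expectation multiplied by [N ^+ n]. The summand is a function on [seq], so that strings can
    be split and joined without casts. *)
Definition tsum n f : R := \sum_(S : n.-tuple Sigma) f S.

Lemma tsum0 f : tsum 0 f = f [::].
Proof.
rewrite /tsum (bigD1 [tuple]) //= big1 ?addr0 // => i.
by move/eqP; case; apply: tuple0.
Qed.

Lemma tsumS n f : tsum n.+1 f = \sum_(a : Sigma) tsum n (fun s => f (a :: s)).
Proof.
rewrite /tsum pair_big /=.
rewrite (reindex (fun p : Sigma * n.-tuple Sigma => [tuple of p.1 :: p.2])) //=.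
exists (fun S : n.+1.-tuple Sigma => (thead S, [tuple of behead S]))
  => [[a s] _|S _] /=.
  by congr (_, _); apply: val_inj.
by rewrite -tuple_eta.
Qed.

Lemma eq_tsum n f g :
  (forall s, size s = n -> f s = g s) -> tsum n f = tsum n g.
Proof. by move=> E; apply: eq_bigr => S _; rewrite E ?size_tuple. Qed.

Lemma ler_tsum n f g :
  (forall s, size s = n -> f s <= g s) -> tsum n f <= tsum n g.
Proof. by move=> E; apply: ler_sum => S _; rewrite E ?size_tuple. Qed.

Lemma tsumD n f g : tsum n (fun s => f s + g s) = tsum n f + tsum n g.
Proof. exact: big_split. Qed.

Lemma tsumZ n c f : tsum n (fun s => c * f s) = c * tsum n f.
Proof. by rewrite /tsum big_distrr. Qed.

Lemma tsum_sum (I : finType) n (F : I -> seq Sigma -> R) :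
  tsum n (fun s => \sum_i F i s) = \sum_i tsum n (F i).
Proof. exact: exchange_big. Qed.

Lemma tsum_const n c : tsum n (fun=> c) = c * N ^+ n.
Proof. by rewrite /tsum sumr_const -[LHS]mulr_natr card_tuple natrX. Qed.

Lemma tsum_cat m k f :
  tsum (m + k) f = tsum m (fun u => tsum k (fun v => f (u ++ v))).
Proof.
elim: m f => [|m IHm] f; first by rewrite tsum0.
by rewrite addSn !tsumS; apply: eq_bigr => a _; rewrite IHm.
Qed.

Lemma tsum_pred1 n u : size u = n -> tsum n (fun v => (u == v)%:R) = 1.
Proof.
move=> <-; rewrite /tsum (bigD1 (in_tuple u)) //= eqxx big1 ?addr0 // => v.
by rewrite -val_eqE /= eq_sym => /negPf ->.
Qed.

Lemma sum_Some_eq_le1 (o : option Sigma) : \sum_(c : Sigma) (Some c == o)%:R <= 1 :> R.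
Proof.
case: o => [a|]; last by rewrite big1.
rewrite (bigD1 a) //= eqxx big1 ?addr0 // => c ne.
by case: eqP => // -[E]; rewrite E eqxx in ne.
Qed.

(** An agreement has probability at most [N ^- b] even if the windows overlap: choosing symbols from
    right to left, each symbol of the first window is forced by the one [q] places later. The
    symbols before position [a] are free. *)
Lemma tsum_agree n a q b : (0 < q)%N -> (a + q + b <= n)%N ->
  tsum n (fun s => (agree s a q b)%:R) * N ^+ b <= N ^+ n.
Proof.
move=> q0; elim: a n => [|a IHa] [|n] le_n; try by lia.
- elim: b n le_n => [|b IHb] n le_n.
    by rewrite expr0 mulr1 (eq_tsum (g := fun=> 1)) // tsum_const mul1r.
  rewrite tsumS; case: n le_n => [|n] le_n; first by lia.
  have le_b : \sum_(c : Sigma) tsum n.+1 (fun s => (agree (c :: s) 0 q b.+1)%:R)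
       <= tsum n.+1 (fun s => (agree s 0 q b)%:R) :> R.
    rewrite -tsum_sum; apply: ler_tsum => s _.
    rewrite (eq_bigr (fun c => (Some c == onth s q.-1)%:R * (agree s 0 q b)%:R)).
      by rewrite -big_distrl /= ler_piMl ?ler0n ?sum_Some_eq_le1.
    move=> c _; rewrite agreeS /= -natrM mulnb add0n.
    by case: q q0 {IHb le_n}.
  rewrite exprS mulrCA.
  apply: le_trans (_ : N * (tsum n.+1 (fun s => (agree s 0 q b)%:R) * N ^+ b) <= _).
    by rewrite ler_wpM2l ?ler0n // ler_wpM2r ?exprn_ge0 ?ler0n.
  by rewrite [leRHS]exprS ler_wpM2l ?ler0n // IHb //; lia.
- rewrite tsumS (eq_bigr (fun=> tsum n (fun s => (agree s a q b)%:R))) //.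
  rewrite sumr_const -[X in X * _]mulr_natl -mulrA exprS.
  by rewrite ler_wpM2l ?ler0n // IHa //; lia.
Qed.

(* A shortest border has this shape. The second disjunct matters for a binary
   alphabet, where the plain union bound over all lengths only gives 1. *)
Definition shortest_border_shape u : bool :=
  (size u == 1%N) || (ohead u != ohead (rev u)).

(** For [l >= 2] the first symbol has to avoid the last one, which excludes a fraction [N^-1] of the
    strings. *)
Lemma tsum_shortest_border_shape l : (0 < #|Sigma|)%N -> (0 < l)%N ->
  tsum l (fun u => (shortest_border_shape u)%:R) <=
  (if l == 1%N then 1 else 1 - N^-1) * N ^+ l.
Proof.
rewrite lt0n => N0; case: l => // -[|l] _ /=.
  rewrite mul1r -[leRHS]mul1r -tsum_const; apply: ler_tsum => s _.
  by case: shortest_border_shape.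
rewrite tsumS -tsum_sum mulrBl mul1r exprS mulrA mulVf ?pnatr_eq0 // mul1r.
rewrite -[X in _ - X]mul1r -mulrBl -tsum_const; apply: ler_tsum => s ss.
have -> : \sum_(a : Sigma) (shortest_border_shape (a :: s))%:R =
    \sum_(a : Sigma) (1 - (Some a == ohead (rev s))%:R) :> R.
  apply: eq_bigr => a _; rewrite /shortest_border_shape /= ss /=.
  have -> : ohead (rev (a :: s)) = ohead (rev s).
    by rewrite rev_cons; case/lastP: s ss => // s x _; rewrite rev_rcons.
  by case: eqP; rewrite ?subrr ?subr0.
rewrite sumrB sumr_const lerD2l lerN2.
case: (lastP s) ss => // s' x _; rewrite rev_rcons /= (bigD1 x) //= eqxx.
by rewrite lerDl sumr_ge0.
Qed.

(** * Exponential moment of the defect *)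

Section Moment.
Hypothesis Sigma_gt1 : (1 < #|Sigma|)%N.
Variable w : R.
Hypotheses (w_ge1 : 1 <= w) (w16 : w ^+ 16 = N).

Let N_gt0 : 0 < N. Proof. by rewrite ltr0n; apply: ltnW. Qed.
Let w_ge0 : 0 <= w. Proof. exact: le_trans w_ge1. Qed.

(** The contribution of a shortest border of length [l]: the defect is at most [2 * l] plus the
    defect of the core, which is the argument of the last [defect]. *)
Definition border_term l n s : R :=
  ((take l s == drop (n - l) s) && shortest_border_shape (take l s))%:R *
  ((w ^+ 2) ^+ l * w ^+ defect (drop l (take (n - l) s))).

Lemma border_term_ge0 l n s : 0 <= border_term l n s.
Proof. by rewrite mulr_ge0 ?ler0n // mulr_ge0 ?exprn_ge0 ?exprn_ge0. Qed.

(** An unbordered string has defect 0 and is covered by the summand 1. Otherwise the term of the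
    shortest border alone suffices, and that border has length at most [n./2]. *)
Lemma defect_recursion n s : size s = n ->
  w ^+ defect s <= 1 + \sum_(i < n./2) border_term i.+1 n s.
Proof.
move=> sn; have [U | /bordered_decomp[u [v [Es u0 bu]]]] := pselect (unbordered s).
  rewrite (defect_unbordered U) expr0 lerDl sumr_ge0 // => i _.
  exact: border_term_ge0.
have nE : n = (size u + (size v + size u))%N by rewrite -sn Es !size_cat.
have lt_u : ((size u).-1 < n./2)%N by lia.
rewrite (bigD1 (Ordinal lt_u)) //= prednK // addrCA.
apply: le_trans (_ : border_term (size u) n s <= _); last first.
  by rewrite lerDl addr_ge0 // sumr_ge0 // => i _; apply: border_term_ge0.
have nu : (n - size u = size (u ++ v))%N.
  by rewrite nE size_cat; lia.
rewrite /border_term nu Es take_size_cat // catA drop_size_cat // take_size_cat //.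
rewrite eqxx drop_size_cat // -catA /shortest_border_shape bu mul1r -exprM -exprD.
rewrite ler_weXn2l //; apply: leq_trans (defect_infix _ _ _) _.
by lia.
Qed.

(** Write the string as [u ++ v ++ u']. Exactly one [u'] equals [u], so the sum over [u'] gives 1,
    and what remains is a product of a function of [u] and a function of [v]. *)
Lemma tsum_border_term l m : (0 < l)%N ->
  tsum (l + (m + l)) (border_term l (l + (m + l))) <=
  (if l == 1%N then 1 else 1 - N^-1) * N ^+ l *
  ((w ^+ 2) ^+ l * tsum m (fun s => w ^+ defect s)).
Proof.
move=> l0; have wl0 : 0 <= (w ^+ 2) ^+ l * tsum m (fun s => w ^+ defect s).
  by rewrite mulr_ge0 ?exprn_ge0 ?exprn_ge0 // sumr_ge0 // => S _; rewrite exprn_ge0.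
apply: le_trans (ler_wpM2r wl0 (tsum_shortest_border_shape (ltnW Sigma_gt1) l0)).
rewrite tsum_cat [leRHS]mulrC -[leRHS]tsumZ; apply: ler_tsum => u su.
rewrite tsum_cat [leRHS]mulrC mulrA -[leRHS]tsumZ; apply: ler_tsum => v sv.
rewrite (eq_tsum (g := fun u' =>
  (shortest_border_shape u)%:R * (w ^+ 2) ^+ l * w ^+ defect v * (u == u')%:R)).
  by rewrite tsumZ tsum_pred1 // mulr1.
move=> u' su'; rewrite /border_term.
have -> : (l + (m + l) - l = size (u ++ v))%N by rewrite size_cat su sv; lia.
have -> : take l (u ++ (v ++ u')) = u by rewrite take_size_cat.
have -> : drop (size (u ++ v)) (u ++ (v ++ u')) = u' by rewrite catA drop_size_cat.
have -> : take (size (u ++ v)) (u ++ (v ++ u')) = u ++ v by rewrite catA take_size_cat.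
by rewrite drop_size_cat //; case: (u == u'); rewrite ?mulr0 ?mul0r ?mulr1 ?mulrA.
Qed.

(** The ratio of the series over border lengths: each border symbol costs two units of defect and
    has to be matched with probability [N^-1]. *)
Let y : R := w ^+ 2 / N.

Lemma ratio_pow8 : y ^+ 8 = (N ^+ 7)^-1.
Proof.
rewrite /y expr_div_n -exprM w16 exprS invfM mulrA mulfV ?mul1r //.
exact: lt0r_neq0.
Qed.

(** Raising to the eighth power eliminates [w], so that only rational numbers are compared. *)
Lemma ratio_bounds : 0 <= y /\ (if #|Sigma| == 2 then y <= 11 / 20 else y <= 2 / 5).
Proof.
have y0 : 0 <= y by rewrite divr_ge0 ?exprn_ge0 // ltW.
split=> //; case: eqP => [E2 | n2].
  rewrite -(@ler_pXn2r _ 8) ?nnegrE //; last by lra.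
  by rewrite ratio_pow8 E2; lra.
have N3 : 3 <= N by rewrite (ler_nat R 3); lia.
rewrite -(@ler_pXn2r _ 8) ?nnegrE //; last by lra.
rewrite ratio_pow8; apply: le_trans (_ : (3 ^+ 7)^-1 <= _); last by lra.
by rewrite lef_pV2 ?posrE ?exprn_gt0 // ler_pXn2r ?nnegrE //; lra.
Qed.

(** Any bound below 1 lets the recursion close. In the binary case it is 11/20 + 1/2 * 121/400 *
    20/9 < 9/10; without the factor 1/2 from the border shape this estimate would exceed 1. *)
Lemma geometric_bound M :
  \sum_(i < M) (if i.+1 == 1%N then 1 else 1 - N^-1) * y ^+ i.+1 <= 9 / 10.
Proof.
have [y0 yb] := ratio_bounds.
case: M => [|M]; first by rewrite big_ord0; lra.
rewrite big_ord_recl /= mul1r expr1.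
have k0 : 0 <= 1 - N^-1 by rewrite subr_ge0 invf_le1 // ler1n; apply: ltnW.
have y1 : y < 1 by move: yb; case: ifP; lra.
have -> : \sum_(i < M) (1 - N^-1) * y ^+ (bump 0 i).+1 =
    (1 - N^-1) * y ^+ 2 * \sum_(i < M) y ^+ i.
  by rewrite big_distrr /=; apply: eq_bigr => i _; rewrite -mulrA -exprD.
have geo : (1 - y) * \sum_(i < M) y ^+ i <= 1.
  by rewrite -opprB mulNr -subrX1 opprB lerBlDr lerDl exprn_ge0.
set G := \sum_(i < M) y ^+ i in geo *.
have G0 : 0 <= G by apply: sumr_ge0 => i _; apply: exprn_ge0.
have y2_ge0 : 0 <= y ^+ 2 by apply: exprn_ge0.
case: eqP yb => [E2 | _] yb.
  have G_le : G <= 20 / 9 by nra.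
  have y2_le : y ^+ 2 <= 121 / 400 by rewrite expr2; nra.
  have : y ^+ 2 * G <= 121 / 400 * (20 / 9) by apply: ler_pM.
  by rewrite E2 -mulrA; lra.
have G_le : G <= 5 / 3 by nra.
have y2_le : y ^+ 2 <= 4 / 25 by rewrite expr2; nra.
have yG : y ^+ 2 * G <= 4 / 25 * (5 / 3) by apply: ler_pM.
have : (1 - N^-1) * (y ^+ 2 * G) <= y ^+ 2 * G.
  apply: ler_piMl; first exact: mulr_ge0.
  by rewrite gerBl invr_ge0 ltW.
by rewrite mulrA; lra.
Qed.

(** Strong induction on the length: the recursion turns the bound 10 for shorter cores into 1 + 10 *
    (9/10) = 10. *)
Lemma tsum_moment n : tsum n (fun s => w ^+ defect s) <= 10 * N ^+ n.
Proof.
have [m] := ubnP n; elim: m n => // m IHm n lt_nm.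
apply: le_trans (ler_tsum (@defect_recursion n)) _.
rewrite tsumD tsum_const mul1r tsum_sum.
have le_l l : (0 < l)%N -> (l + l <= n)%N -> tsum n (border_term l n) <=
   10 * N ^+ n * ((if l == 1%N then 1 else 1 - N^-1) * y ^+ l).
  move=> l0 le_l; set K := if _ then _ else _.
  have K0 : 0 <= K.
    by rewrite /K; case: ifP => // _; rewrite subr_ge0 invf_le1 // ler1n; apply: ltnW.
  have En : n = (l + ((n - (l + l)) + l))%N by lia.
  rewrite [X in tsum X]En [in border_term _ _]En.
  apply: le_trans (tsum_border_term _ l0) _.
  rewrite -/K; set k := (n - (l + l))%N in En *.
  set A := N ^+ l; set B := (w ^+ 2) ^+ l.
  have A0 : A != 0 by rewrite expf_neq0 // lt0r_neq0.
  have -> : 10 * N ^+ n * (K * y ^+ l) = K * A * (B * (10 * N ^+ k)).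
    by rewrite /y expr_div_n -/A -/B En !exprD -/A; field.
  apply: ler_wpM2l; first by rewrite mulr_ge0 // exprn_ge0 // ltW.
  apply: ler_wpM2l; first by rewrite !exprn_ge0.
  by apply: IHm; lia.
have le_i (i : 'I_(n./2)) : tsum n (border_term i.+1 n) <=
   10 * N ^+ n * ((if i.+1 == 1%N then 1 else 1 - N^-1) * y ^+ i.+1).
  by apply: le_l => //; have := ltn_ord i; lia.
apply: le_trans (_ : N ^+ n + 10 * N ^+ n * (9 / 10) <= _); last first.
  by have : 0 <= N ^+ n by [rewrite exprn_ge0 // ltW]; lra.
rewrite lerD2l; apply: le_trans (ler_sum _ (fun i _ => le_i i)) _.
rewrite -big_distrr /= ler_wpM2l ?geometric_bound //.
by rewrite mulr_ge0 // exprn_ge0 // ltW.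
Qed.

End Moment.

End TupleSum.

(** * Average cost of the search *)

(** Because (26/25) ^ 16 < 2, the lower bound on [w] holds for all alphabets at once, which keeps
    the later constants independent of [N]. *)
Lemma root16_exists (R : realType) (N : nat) : (1 < N)%N ->
  exists2 w : R, 26 / 25 <= w & w ^+ 16 = N%:R.
Proof.
move=> N1; have N0 : 0 < N%:R :> R by rewrite ltr0n ltnW.
pose w : R := expR (ln N%:R / 16).
have w16 : w ^+ 16 = N%:R.
  by rewrite /w -expRM_natl mulrC divfK ?lnK ?posrE // pnatr_eq0.
exists w => //.
rewrite -(@ler_pXn2r _ 16) ?nnegrE ?expR_ge0 //; last by lra.
have N2 : 2 <= N%:R :> R by rewrite (ler_nat R 2).
by rewrite w16; apply: le_trans N2; lra.
Qed.

(** Bernoulli's inequality for 1 + 1/52, then squared: (53/52) ^ 2 <= 26/25 and 52 ^ 2 = 2704. *)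
Lemma sqr_le_exp (R : realType) (w : R) m : 26 / 25 <= w ->
  (m.+1 ^ 2)%:R <= 2704 * w ^+ m.
Proof.
move=> w_ge; have lin k : k%:R + 52 <= 52 * (53 / 52) ^+ k :> R.
  elim: k => [|k IHk]; first by rewrite expr0; lra.
  rewrite exprS -natr1; have : 0 <= k%:R :> R by [].
  by move: IHk; set A := _ ^+ k; lra.
have le1 : m.+1%:R <= 52 * (53 / 52) ^+ m :> R.
  by rewrite -natr1; have := lin m; lra.
have le2 : ((53 / 52) ^+ m) ^+ 2 <= w ^+ m.
  rewrite -exprM mulnC exprM; apply: lerXn2r; rewrite ?nnegrE; lra.
rewrite natrX; apply: le_trans (_ : (52 * (53 / 52) ^+ m) ^+ 2 <= _).
  by apply: lerXn2r; rewrite ?nnegrE // mulr_ge0 // exprn_ge0 //; lra.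
have -> : 2704 = (52 : R) ^+ 2 by ring.
by rewrite exprMn ler_wpM2l // exprn_ge0.
Qed.

Lemma sum_odd_half (R : realType) m :
  \sum_(t < m) (t.*2.+1)%:R / 2 ^+ t <= 6 :> R.
Proof.
have -> : \sum_(t < m) (t.*2.+1)%:R / 2 ^+ t = 6 - (4 * m%:R + 6) / 2 ^+ m :> R.
  elim: m => [|m IHm]; first by rewrite big_ord0 expr0; lra.
  rewrite big_ord_recr /= IHm exprS -natr1 -[m.*2.+1%:R]natr1 -muln2 natrM.
  by field; rewrite expf_neq0 // pnatr_eq0.
by rewrite gerBl divr_ge0 ?exprn_ge0 // addr_ge0 // mulr_ge0.
Qed.

Lemma sum_arith_geom (R : realType) m :
  \sum_(e < m) e.+1%:R * (51 / 52) ^+ e <= 2704 :> R.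
Proof.
have -> : \sum_(e < m) e.+1%:R * (51 / 52) ^+ e =
    2704 - (51 / 52) ^+ m * (2704 + 52 * m%:R) :> R.
  elim: m => [|m IHm]; first by rewrite big_ord0 expr0; lra.
  by rewrite big_ord_recr /= IHm exprS -natr1; set A := _ ^+ m; field.
rewrite gerBl mulr_ge0 ?exprn_ge0 //; first by lra.
by rewrite addr_ge0 // mulr_ge0.
Qed.

Lemma sum_odd m : (\sum_(t < m) t.*2.+1 = m ^ 2)%N.
Proof. by elim: m => [|m IHm]; rewrite ?big_ord0 // big_ord_recr /= IHm; lia. Qed.

(** Each of the three sums has at most [n] terms, and each comparison costs at most [n]. *)
Lemma search_cost_crude (Sigma : finType) (S : seq Sigma) n d :
  size S = n -> (0 < n)%N -> (search_cost S d <= n ^ 4)%N.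
Proof.
move=> sn n0; have L0 : (0 < L S)%N by apply: L_gt0; rewrite sn.
have p0 := per_gt0 (factor S d.+1 (n - d)).
rewrite /search_cost sn.
have leq_const m k (F : nat -> nat) (c : nat) : (m <= k)%N ->
    (forall i, (i < m)%N -> (F i <= c)%N) -> (\sum_(i < m) F i <= k * c)%N.
  move=> le_mk H; apply: leq_trans (_ : m * c <= _)%N; last first.
    by rewrite leq_mul2r le_mk orbT.
  rewrite -[X in (_ <= X * c)%N]card_ord -sum_nat_const.
  by apply: leq_sum => i _; apply: H.
rewrite !expnS expn0 muln1.
apply: (leq_const _ n (fun e => \sum_(a < e.+1)
  \sum_(b < (border_bound S d e).+1) (1 + agree_len S a (n - e - b) b))%N);
  first by lia.
move=> e lt_e; apply: (leq_const _ n (fun a =>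
  \sum_(b < (border_bound S d e).+1) (1 + agree_len S a (n - e - b) b))%N);
  first by lia.
move=> a lt_a.
have le_b : (border_bound S d e < n)%N.
  by rewrite /border_bound sn; case: ifP => _; lia.
apply: (leq_const _ _ (fun b => 1 + agree_len S a (n - e - b) b)%N) => // b lt_b.
by have := agree_len_leq S a (n - e - b) b; lia.
Qed.

(** In the good case all ranges are bounded in terms of [d]. The random stopping point becomes an
    indicator, so that the ranges no longer depend on [S] and the sums can be exchanged with the
    expectation. *)
Lemma search_cost_good (Sigma : finType) (S : seq Sigma) n d : size S = n ->
  (defect S <= d)%N -> (n <= per (factor S d.+1 (n - d)) + 3 * d)%N ->
  (search_cost S d <= \sum_(e < d.+1) \sum_(a < e.+1) \sum_(b < (3 * d).+1)
     (e <= defect S) * (1 + agree_len S a (n - e - b) b))%N.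
Proof.
move=> sn le_d le_p; rewrite /search_cost sn.
have Ed : defect S = (n - L S)%N by rewrite /defect sn.
rewrite -Ed (big_ord_widen d.+1 (fun e => \sum_(a < e.+1)
  \sum_(b < (border_bound S d e).+1) (1 + agree_len S a (n - e - b) b))%N) //.
rewrite big_mkcond; apply: leq_sum => -[e lt_e] _ /=; rewrite ltnS.
case: (e <= defect S)%N => //; apply: leq_sum => a _.
have le_b : ((border_bound S d e).+1 <= (3 * d).+1)%N.
  by rewrite /border_bound sn; case: ifP => ?; lia.
rewrite (big_ord_widen _ (fun b => 1 + agree_len S a (n - e - b) b)%N le_b).
rewrite big_mkcond; apply: leq_sum => b _; rewrite mul1n.
by case: ifP.
Qed.

Section Average.
Variables (R : realType) (Sigma : finType) (w : R).
Local Notation N := (#|Sigma|%:R : R).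
Hypothesis Sigma_gt1 : (1 < #|Sigma|)%N.
Hypotheses (w_ge : 26 / 25 <= w) (w16 : w ^+ 16 = N).
Local Notation rho := (51 / 52 : R).

Let w_ge1 : 1 <= w. Proof. by apply: le_trans w_ge; lra. Qed.
Let N_gt0 : 0 < N. Proof. by rewrite ltr0n; apply: ltnW. Qed.
Let N_ge2 : 2 <= N. Proof. by rewrite (ler_nat R 2). Qed.

(** A square is a sum of odd numbers, and the term [t] occurs only if [t] symbols agree, which has
    probability at most 2 ^ -t. *)
Lemma tsum_agree_len_sqr n a q b : (0 < q)%N -> (a + q + b <= n)%N ->
  tsum n (fun s : seq Sigma => ((1 + agree_len s a q b) ^ 2)%:R) <= 6 * N ^+ n.
Proof.
move=> q0 le_n.
apply: le_trans (_ : tsum n (fun s : seq Sigma =>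
  \sum_(t < b.+1) (t.*2.+1)%:R * (agree s a q t)%:R) <= _).
  apply: ler_tsum => s _; rewrite add1n -sum_odd natr_sum.
  have le_M := agree_len_leq s a q b.
  rewrite -(big_mkord xpredT (fun t => (t.*2.+1)%:R : R)).
  rewrite -(big_mkord xpredT (fun t => (t.*2.+1)%:R * (agree s a q t)%:R)).
  rewrite [leRHS](@big_cat_nat _ _ _ (agree_len s a q b).+1) //=.
  rewrite [X in X + _](eq_big_nat _ _ (F2 := fun t => (t.*2.+1)%:R)).
    by rewrite lerDl sumr_ge0 // => t _; rewrite mulr_ge0.
  by move=> t /andP[_ le_t]; rewrite (@agree_leq_len _ _ _ _ b) // mulr1.
rewrite tsum_sum.
apply: le_trans (_ : \sum_(t < b.+1) ((t.*2.+1)%:R / 2 ^+ t) * N ^+ n <= _).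
  apply: ler_sum => t _; rewrite tsumZ -mulrA ler_wpM2l //.
  rewrite ler_pdivlMl ?exprn_gt0 //.
  apply: le_trans (@tsum_agree R Sigma n a q t q0 _); last by have := ltn_ord t; lia.
  rewrite mulrC ler_wpM2l ?sumr_ge0 //; apply: lerXn2r; rewrite ?nnegrE //.
by rewrite -big_distrl /= ler_wpM2r ?exprn_ge0 ?sum_odd_half // ltW.
Qed.

(** The defect and the agreement length [z] are dependent. They are decoupled by
    [z <= r * (w ^+ defect s + z ^+ 2)], valid when [e <= defect s]; the two moments then give 16 =
    10 + 6. *)
Lemma tsum_weighted_agree_len n e a q b : (0 < q)%N -> (a + q + b <= n)%N ->
  tsum n (fun s : seq Sigma =>
            (e <= defect s)%N%:R * (1 + agree_len s a q b)%:R) <=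
  16 * rho ^+ e * N ^+ n.
Proof.
move=> q0 le_n; set r := rho ^+ e.
have r0 : 0 < r by rewrite exprn_gt0 //; lra.
apply: le_trans (_ : tsum n (fun s : seq Sigma =>
  r * (w ^+ defect s + ((1 + agree_len s a q b) ^ 2)%:R)) <= _); last first.
  rewrite tsumZ tsumD [16 * r]mulrC -mulrA ler_wpM2l ?(ltW r0) //.
  have := tsum_moment Sigma_gt1 w_ge1 w16 n.
  by have := tsum_agree_len_sqr q0 le_n; lra.
apply: ler_tsum => s _; rewrite natrX.
have D0 : 0 <= w ^+ defect s by rewrite exprn_ge0 // (le_trans _ w_ge1).
pose z : R := (1 + agree_len s a q b)%:R; rewrite -/z.
have z0 : 0 <= z by [].
case: leqP => le_e; last first.
  rewrite mul0r; apply: mulr_ge0; first exact: ltW.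
  by apply: addr_ge0 => //; apply: exprn_ge0.
(* The value of [rho] is chosen so that (51/52) ^ 2 * (26/25) >= 1. *)
have rD : 1 <= r ^+ 2 * w ^+ defect s.
  apply: le_trans (_ : r ^+ 2 * w ^+ e <= _); last first.
    by apply: ler_wpM2l; [apply/exprn_ge0/ltW | rewrite ler_weXn2l].
  rewrite /r -exprM mulnC exprM -exprMn exprn_ege1 //.
  have : rho ^+ 2 * (26 / 25) <= rho ^+ 2 * w; last by lra.
  by rewrite ler_wpM2l // exprn_ge0 //; lra.
(* With x := r z: r^2 D + x^2 >= 1 + x^2 >= x. *)
rewrite mul1r -(ler_pM2l r0) mulrA -expr2 mulrDr.
have -> : r ^+ 2 * z ^+ 2 = (r * z) ^+ 2 by rewrite exprMn.
set x := r * z; have : 0 <= (x - 1 / 2) ^+ 2 by apply: sqr_ge0.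
by rewrite !expr2; lra.
Qed.

(** The first two terms charge the crude cost to the bad events. A defect above [d] is handled as in
    Markov's inequality; a period [p] of the queried factor with [p + 3 * d < n] makes the window of
    length [d] at [d] agree with its shift by [p], and a union bound over [p] follows. *)
Lemma search_cost_le (S : seq Sigma) n d : size S = n -> (0 < n)%N ->
  (search_cost S d)%:R <=
  (n ^ 4)%:R * (w ^+ defect S / w ^+ d) +
  (n ^ 4)%:R * \sum_(i < n - (d + d)) (agree S d i.+1 d)%:R +
  \sum_(e < d.+1) \sum_(a < e.+1) \sum_(b < (3 * d).+1)
     (e <= defect S)%N%:R * (1 + agree_len S a (n - e - b) b)%:R :> R.
Proof.
move=> sn n0; have crude := search_cost_crude d sn n0.
have w_gt0 : 0 < w by apply: lt_le_trans w_ge1.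
set T1 := _ * (_ / _); set T2 := _ * \sum_(i < _) _; set T3 := \sum_(e < _) _.
have T10 : 0 <= T1 by rewrite mulr_ge0 // divr_ge0 // exprn_ge0 // ltW.
have T20 : 0 <= T2 by rewrite mulr_ge0 // sumr_ge0.
have T30 : 0 <= T3.
  apply: sumr_ge0 => e _; apply: sumr_ge0 => a _; apply: sumr_ge0 => b _.
  by rewrite mulr_ge0.
have [le_d | lt_d] := leqP (defect S) d; last first.
  have : (n ^ 4)%:R <= T1.
    apply: ler_peMr => //; rewrite ler_pdivlMr ?exprn_gt0 // mul1r.
    by rewrite ler_weXn2l // ltnW.
  by have : (search_cost S d)%:R <= (n ^ 4)%:R :> R; [rewrite ler_nat | lra].
set p := per (factor S d.+1 (n - d)).
have [le_p | lt_p] := leqP n (p + 3 * d); last first.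
  have : (n ^ 4)%:R <= T2.
    have p0 : (0 < p)%N := per_gt0 _.
    have lt_i : (p.-1 < n - (d + d))%N by lia.
    apply: ler_peMr => //; rewrite (bigD1 (Ordinal lt_i)) //= prednK //.
    have -> : agree S d p d.
      have := perP (factor S d.+1 (n - d)); rewrite periodP -/p p0 /=.
      rewrite size_factor ?sn ?leq_subr //= => /agreeP H.
      apply/agreeP => t lt_t; have := H t ltac:(lia).
      rewrite !onth_factor /=; try by lia.
      by congr (onth _ _ = onth _ _); lia.
    by rewrite lerDl sumr_ge0.
  by have : (search_cost S d)%:R <= (n ^ 4)%:R :> R; [rewrite ler_nat | lra].
have : (search_cost S d)%:R <= T3; last by lra.
apply: le_trans (_ : _ <= (\sum_(e < d.+1) \sum_(a < e.+1) \sum_(b < (3 * d).+1)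
     (e <= defect S) * (1 + agree_len S a (n - e - b) b))%N%:R) _.
  by rewrite ler_nat; apply: search_cost_good.
rewrite natr_sum; apply: ler_sum => e _; rewrite natr_sum; apply: ler_sum => a _.
by rewrite natr_sum; apply: ler_sum => b _; rewrite natrM.
Qed.

(** With [d = 64 * g], the bad events contribute 10 and 1, because [w ^+ d = N ^+ (4 * g)] outweighs
    [n ^ 4] and [N ^+ d] outweighs [n ^ 5]. The good case has [3 * d + 1] border lengths and [e + 1]
    offsets, summed against [rho ^+ e]. The assumption [256 * g < n] says [4 * d < n], which keeps
    all shifts [n - e - b] positive. *)
Lemma tsum_search_cost n g : (n <= #|Sigma| ^ g)%N -> (256 * g < n)%N ->
  tsum n (fun S : seq Sigma => (search_cost S (64 * g))%:R) <=
  (11 + 16 * (192 * g%:R + 1) * 2704) * N ^+ n.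
Proof.
move=> le_n lt_g; have n0 : (0 < n)%N by lia.
have [d Ed] : exists d, d = (64 * g)%N by eexists.
rewrite -Ed.
have w_gt0 : 0 < w by apply: lt_le_trans w_ge1.
have n_le : n%:R <= N ^+ g by rewrite -natrX ler_nat.
apply: le_trans (ler_tsum (fun (S : seq Sigma) sn => search_cost_le d sn n0)) _.
rewrite 2!tsumD 2!tsumZ; set K := 16 * _ * _.
have -> : (11 + K) * N ^+ n = 10 * N ^+ n + N ^+ n + K * N ^+ n by ring.
apply: lerD; first apply: lerD.
- rewrite (eq_tsum (g := fun s : seq Sigma => (w ^+ d)^-1 * w ^+ defect s)); last first.
    by move=> s _; rewrite mulrC.
  rewrite tsumZ mulrA.
  apply: le_trans (_ : 1 * tsum n (fun s : seq Sigma => w ^+ defect s) <= _).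
    apply: ler_wpM2r; first by apply: sumr_ge0 => S _; apply/exprn_ge0/ltW.
    rewrite ler_pdivrMr ?exprn_gt0 // mul1r natrX (_ : d = 16 * (g * 4))%N; last by lia.
    by rewrite exprM w16 exprM lerXn2r ?nnegrE ?exprn_ge0 // ltW.
  by rewrite mul1r; apply: tsum_moment.
- rewrite tsum_sum.
  apply: le_trans (_ : (n ^ 4)%:R * (n%:R * (N ^+ n / N ^+ d)) <= _).
    apply: ler_wpM2l => //.
    apply: le_trans (_ : \sum_(i < n - (d + d)) (N ^+ n / N ^+ d) <= _).
      apply: ler_sum => i _; rewrite ler_pdivlMr ?exprn_gt0 //.
      by apply: tsum_agree => //; have := ltn_ord i; lia.
    rewrite sumr_const card_ord -[leLHS]mulr_natl; apply: ler_wpM2r.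
      by apply: divr_ge0; apply/exprn_ge0/ltW.
    by rewrite ler_nat leq_subr.
  rewrite mulrA -natrM -expnSr mulrCA ger_pMr ?exprn_gt0 //.
  rewrite ler_pdivrMr ?exprn_gt0 // mul1r natrX.
  apply: le_trans (_ : (N ^+ g) ^+ 5 <= _).
    by rewrite lerXn2r ?nnegrE ?exprn_ge0 // ltW.
  rewrite -exprM ler_weXn2l //; [by apply: le_trans N_ge2; lra | by lia].
- rewrite tsum_sum.
  apply: le_trans (_ : \sum_(e < d.+1)
    16 * (192 * g%:R + 1) * N ^+ n * (e.+1%:R * rho ^+ e) <= _).
    apply: ler_sum => e _; have lt_e := ltn_ord e.
    rewrite tsum_sum.
    apply: le_trans (_ : \sum_(a < e.+1) \sum_(b < (3 * d).+1)
      (16 * rho ^+ e * N ^+ n) <= _).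
      apply: ler_sum => a _; have lt_a := ltn_ord a.
      rewrite tsum_sum; apply: ler_sum => b _; have lt_b := ltn_ord b.
      by apply: tsum_weighted_agree_len ; lia.
    rewrite !sumr_const !card_ord -[X in X *+ e.+1]mulr_natl -[X in X <= _]mulr_natl.
    have -> : (3 * d).+1%:R = 192 * g%:R + 1 :> R.
      by rewrite -natr1 Ed mulnA natrM.
    by rewrite le_eqVlt; apply/orP; left; apply/eqP; ring.
  rewrite -big_distrr /= /K [leRHS]mulrAC; apply: ler_wpM2l; last exact: sum_arith_geom.
  by rewrite !mulr_ge0 ?addr_ge0 ?mulr_ge0 ?exprn_ge0 // ltW.
Qed.

End Average.

(** From [n > 2 ^ (g - 1)] and [n <= 256 * g]: already at [g = 13] one has 2 ^ 12 > 256 * 13.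
    Strings too short for the margin therefore have bounded length. *)
Lemma up_log_small sigma n :
  (1 < sigma)%N -> (0 < n)%N -> (n <= 256 * up_log sigma n)%N ->
  (up_log sigma n <= 12)%N.
Proof.
move=> s1 n0 le_n; rewrite leqNgt; apply/negP => gt12.
set g := up_log sigma n in le_n gt12.
have [j Ej] : exists j, (g = 13 + j)%N by exists (g - 13)%N; lia.
have n1 : (1 < n)%N.
  rewrite ltnNge; apply/negP => le1; have := up_log_eq0 sigma n.
  by rewrite le1 orbT -/g Ej.
have lt_n : (2 ^ (12 + j) < n)%N.
  have -> : (12 + j = g.-1)%N by rewrite Ej.
  by apply: leq_ltn_trans (up_log_gtn s1 n1); rewrite leq_exp2r // Ej.
have : (2 ^ (12 + j) = 256 * 16 * 2 ^ j)%N by rewrite (expnD 2 12) (expnD 2 8 4).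
have := ltn_expl j (isT : (1 < 2)%N).
by move: lt_n; set A := (2 ^ (12 + j))%N; set B := (2 ^ j)%N; lia.
Qed.

(** Rounding up adds at most 1 to the logarithm, so the left side is at most the logarithm plus
    2. *)
Lemma up_log_le_logb (R : realType) sigma n : (1 < sigma)%N -> (0 < n)%N ->
  (up_log sigma n).+1%:R <= 3 * Num.max 1 (logb R sigma n).
Proof.
move=> s1 n0; set M := Num.max _ _; set g := up_log sigma n.
have M1 : 1 <= M by rewrite le_max lexx.
have [le_g | gt_g] := leqP g 1.
  apply: le_trans (_ : 2 <= _); last by lra.
  by rewrite (ler_nat R _ 2).
have n1 : (1 < n)%N.
  rewrite ltnNge; apply/negP => le1; have := up_log_eq0 sigma n.
  by rewrite le1 orbT -/g => /eqP E; rewrite E in gt_g.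
have ln_gt0 : 0 < ln sigma%:R :> R by rewrite ln_gt0 // ltr1n.
have le_log : g.-1%:R <= logb R sigma n.
  rewrite ler_pdivlMr // mulr_natl -lnXn ?ltr0n ?(ltnW s1) //.
  rewrite ler_ln ?posrE ?exprn_gt0 ?ltr0n ?(ltnW s1) //.
  by rewrite -natrX ler_nat ltnW // up_log_gtn.
have le_M : logb R sigma n <= M by rewrite le_max lexx orbT.
have -> : g.+1 = (g.-1 + 2)%N by lia.
by rewrite natrD; lra.
Qed.

(** * Mean running times of the two reductions *)

Lemma uniform_mean_le (R : realType) (Sigma : finType) n
    (X : n.-tuple Sigma -> nat) (f : seq Sigma -> R) c :
  (0 < #|Sigma|)%N -> (forall S : n.-tuple Sigma, (X S)%:R <= f S) ->
  tsum n f <= c * #|Sigma|%:R ^+ n -> uniform_mean R X <= c.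
Proof.
move=> s0 le_X le_f; rewrite /uniform_mean card_tuple natrX.
rewrite ler_pdivrMr ?exprn_gt0 ?ltr0n //.
by apply: le_trans le_f; apply: ler_sum => S _.
Qed.

Lemma L_from_per_mean (R : realType) : exists C : R,
  forall (Sigma : finType) (n : nat) (time : n.-tuple Sigma -> nat),
  (1 < #|Sigma|)%N -> (0 < n)%N ->
  let g := up_log #|Sigma| n in
  (forall S, time S <= 200 * (g.+1 + search_cost S (minn (64 * g) ((n - 1) %/ 2))))%N ->
  uniform_mean R time <= C * Num.max 1 (logb R #|Sigma| n).
Proof.
(* [K1] is the coefficient of [g] in [tsum_search_cost]; [K2] is the crude cost of strings with
   [n <= 256 * g] and [g <= 12]. Both stay opaque for the arithmetic below. *)
have [K1 EK1] : exists K1 : R, K1 = 16 * 192 * 2704 by exists (16 * 192 * 2704).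
have [K2 EK2] : exists K2 : R, K2 = (256 * 12)%N%:R ^+ 4
  by exists ((256 * 12)%N%:R ^+ 4).
have K1_ge : 0 <= K1 by rewrite EK1; lra.
have K2_ge : 0 <= K2 by rewrite EK2 exprn_ge0.
exists (200 * (12 + K1 + K2) * 3) => Sigma n time s1 n0 g le_time.
have [w w_ge w16] := root16_exists R s1.
set d := minn _ _ in le_time.
have g0 : 0 <= g%:R :> R by [].
apply: le_trans (_ : 200 * (12 + K1 + K2) * g.+1%:R <= _); last first.
  rewrite -[leRHS]mulrA; apply: ler_wpM2l; first by lra.
  exact: up_log_le_logb.
apply: (uniform_mean_le (f := fun S => 200 * (g.+1%:R + (search_cost S d)%:R))).
- exact: ltnW.
- by move=> S; rewrite -natrD -natrM ler_nat.
rewrite tsumZ tsumD tsum_const -!mulrA ler_wpM2l //.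
have N0 : 0 <= #|Sigma|%:R ^+ n :> R by rewrite exprn_ge0.
set Nn := #|Sigma|%:R ^+ n in N0 *.
rewrite (mulrA _ g.+1%:R).
suff le_cost : tsum n (fun S : seq Sigma => (search_cost S d)%:R) <=
    (11 + K1 + K2) * g.+1%:R * Nn.
  have := le_cost; set A := tsum _ _; set x : R := g.+1%:R; nra.
have [le_n | gt_n] := leqP n (256 * g).
  have g12 : (g <= 12)%N by apply: up_log_small.
  apply: le_trans (_ : tsum n (fun _ : seq Sigma => K2) <= _).
    apply: ler_tsum => S sn; apply: le_trans (_ : (n ^ 4)%:R <= _).
      by rewrite ler_nat; apply: search_cost_crude.
    rewrite EK2 natrX lerXn2r ?nnegrE // ler_nat (leq_trans le_n) //.
    by rewrite leq_mul2l.
  rewrite tsum_const -/Nn ler_wpM2r // -natr1; nra.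
have -> : d = (64 * g)%N by apply/minn_idPl; lia.
apply: le_trans (tsum_search_cost s1 w_ge w16 _ gt_n) _; first exact: up_logP.
rewrite -/Nn ler_wpM2r // -natr1 EK1; nra.
Qed.

Lemma per_from_L_mean (R : realType) : exists C : R,
  forall (Sigma : finType) (n : nat) (time : n.-tuple Sigma -> nat), (0 < n)%N ->
  (forall S : n.-tuple Sigma,
     time S <= 100 * (if #|Sigma| == 1 then 1 else (size S - L S).+1 ^ 2))%N ->
  uniform_mean R time <= C.
Proof.
exists (100 * (2704 * 10)) => Sigma n time n0 le_time.
have [s0 | s0] := posnP #|Sigma|.
  (* Over the empty alphabet there is no string of positive length, and the mean is 0 because the
     inverse of 0 is 0. *)
  rewrite /uniform_mean card_tuple s0 exp0n // invr0 mulr0; lra.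
have [s1 | ns1] := eqVneq #|Sigma| 1%N.
  apply: (uniform_mean_le (f := fun=> 100)) => //.
    by move=> S; rewrite (ler_nat R _ 100); have := le_time S; rewrite s1.
  rewrite tsum_const ler_wpM2r ?exprn_ge0 //; lra.
have s2 : (1 < #|Sigma|)%N by lia.
have [w w_ge w16] := root16_exists R s2.
have w_ge1 : 1 <= w by lra.
apply: (uniform_mean_le (f := fun s => 100 * (2704 * w ^+ defect s))) => //.
  move=> S; apply: le_trans (_ : (100 * (size S - L S).+1 ^ 2)%:R <= _).
    by rewrite ler_nat; have := le_time S; rewrite (negPf ns1).
  by rewrite natrM ler_wpM2l // sqr_le_exp.
rewrite !tsumZ -!mulrA !ler_wpM2l //.
exact: tsum_moment.
Qed.

Theorem theorem2 (R : realType) :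
  (exists (P : cmd) (k : nat) (C : R),
     forall (Sigma : finType) (n : nat), (1 < #|Sigma|)%N -> (0 < n)%N ->
     exists (i j : nat) (time : n.-tuple Sigma -> nat),
       [/\ (0 < i <= j)%N && (j <= n)%N,
           forall S : n.-tuple Sigma,
             computes_with_query k P (@L Sigma) (@per Sigma) S i j (time S)
         & uniform_mean R time <= C * Num.max 1 (logb R #|Sigma| n)])
  /\
  (exists (P : cmd) (k : nat) (C : R),
     forall (Sigma : finType) (n : nat), (0 < n)%N ->
     exists time : n.-tuple Sigma -> nat,
       (forall S : n.-tuple Sigma,
          computes_with_query k P (@per Sigma) (@L Sigma) S 1 n (time S))
       /\ uniform_mean R time <= C).
Proof.
split.
  have [C HC] := L_from_per_mean R.
  exists L_from_per_cmd, 6%N, C => Sigma n s1 n0.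
  set g := up_log #|Sigma| n; set d := minn (64 * g) ((n - 1) %/ 2).
  have /choice[time Htime] (S : n.-tuple Sigma) : exists t,
      computes_with_query 6 L_from_per_cmd (@L Sigma) (@per Sigma) S d.+1 (n - d) t
      /\ (t <= 200 * (g.+1 + search_cost S d))%N.
    have sS : (0 < size S)%N by rewrite size_tuple.
    have [t Ht le_t] := L_from_per_correct s1 sS; rewrite size_tuple in Ht le_t.
    by exists t.
  (* The margin [d] depends on [n] and the alphabet size only, so the same factor is queried for
     every string. *)
  exists d.+1, (n - d)%N, time; split.
  - by rewrite /d; lia.
  - by move=> S; have [] := Htime S.
  - by apply: HC => // S; have [] := Htime S.
have [C HC] := per_from_L_mean R.
exists per_from_L_cmd, 6%N, C => Sigma n n0.
have /choice[time Htime] (S : n.-tuple Sigma) : exists t,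
    computes_with_query 6 per_from_L_cmd (@per Sigma) (@L Sigma) S 1 n t /\
    (t <= 100 * (if #|Sigma| == 1 then 1 else (size S - L S).+1 ^ 2))%N.
  have sS : (0 < size S)%N by rewrite size_tuple.
  have [t Ht le_t] := per_from_L_correct sS.
  rewrite [X in computes_with_query _ _ _ _ _ _ X]size_tuple in Ht.
  by exists t.
exists time; split=> [S|]; first by have [] := Htime S.
by apply: HC => // S; have [] := Htime S.
Qed.
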